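(* For each fixed integer $p\geq 2$, the following decision problem is NP-complete, even when the input is restricted to bipartite graphs: given a graph $G$, decide whether $G$ has a $P_3^*$-convex $p$-partition.
   Context: Graphs are finite, undirected, without loops or multiple edges. A set $S\subseteq V(G)$ is $P_3^*$-convex if for every induced path on three vertices of $G$ whose two end-vertices belong to $S$, the middle vertex also belongs to $S$. A $P_3^*$-convex $p$-partition of $G$ is a partition of $V(G)$ into $p$ nonempty pairwise disjoint $P_3^*$-convex sets $V_1,\ldots,V_p$, each different from $V(G)$. *)

(* Defs.v *)
From mathcomp Require Import all_boot.

Set Implicit Arguments.
Unset Strict Implicit.
Unset Printing Implicit Defensive.

(** * Multi-tape Turing machines *)

Inductive move := MoveLeft | MoveStay | MoveRight.

(* [None] is the blank, [Some (inl b)] an input/output bit, [Some (inr g)] an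
   auxiliary work symbol. *)
Definition symbol (G : finType) : finType := option (bool + G).

(* Two-way infinite tape: (cells left of the head, nearest first; scanned cell;
   cells right of the head, nearest first); all cells not listed are blank. *)
Definition tape (G : finType) : Type := seq (symbol G) * symbol G * seq (symbol G).

Definition tape_read G (t : tape G) : symbol G := t.1.2.

Definition tape_write G (a : symbol G) (t : tape G) : tape G := (t.1.1, a, t.2).

Definition tape_move G (m : move) (t : tape G) : tape G :=
  let: (l, a, r) := t in
  match m with
  | MoveLeft => (behead l, head None l, a :: r)
  | MoveStay => t
  | MoveRight => (a :: l, head None r, behead r)
  end.

(* The head is initially on the first bit. *)
Definition tape_of_bits G (w : seq bool) : tape G :=
  let s : seq (symbol G) := [seq Some (inl b) | b <- w] in
  ([::], head None s, behead s).

Fixpoint leading_bits G (s : seq (symbol G)) : seq bool :=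
  if s is Some (inl b) :: s' then b :: leading_bits s' else [::].

(* The word starting at the head and ending before the first non-bit. *)
Definition tape_output G (t : tape G) : seq bool := leading_bits (t.1.2 :: t.2).

(* Deterministic machine with [tm_extra.+1] tapes; a transition writes and then
   moves on every tape, and the machine halts when [tm_trans] returns [None]. *)
Record tm := TM {
  tm_work : finType;
  tm_state : finType;
  tm_extra : nat;
  tm_start : tm_state;
  tm_accept : pred tm_state;
  tm_trans : tm_state -> {ffun 'I_tm_extra.+1 -> symbol tm_work} ->
    option (tm_state * {ffun 'I_tm_extra.+1 -> symbol tm_work * move})
}.

Section Run.

Variable M : tm.

Definition config : Type :=
  tm_state M * {ffun 'I_(tm_extra M).+1 -> tape (tm_work M)}.

(* The i-th input word is written on tape i; all other tapes are blank. *)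
Definition tm_init (ws : seq (seq bool)) : config :=
  (tm_start M, [ffun i : 'I__ => tape_of_bits (tm_work M) (nth [::] ws i)]).

Definition tm_next (c : config) :=
  tm_trans c.1 [ffun i => tape_read (c.2 i)].

Definition tm_step (c : config) : config :=
  if tm_next c is Some (q, act)
  then (q, [ffun i => tape_move (act i).2 (tape_write (act i).1 (c.2 i))])
  else c.

Definition tm_halted (c : config) : bool := ~~ isSome (tm_next c).

Definition tm_run (ws : seq (seq bool)) (t : nat) : config :=
  iter t tm_step (tm_init ws).

End Run.

(** * Polynomial time, NP and NP-completeness *)

(* Every polynomial in n is dominated by some n ^ k + k. *)
Definition poly_bound (k n : nat) : nat := n ^ k + k.

Definition poly_time_computable (f : seq bool -> seq bool) : Prop :=
  exists (M : tm) (k : nat), forall w : seq bool,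
    let c := tm_run M [:: w] (poly_bound k (size w)) in
    tm_halted c /\ tape_output (c.2 ord0) = f w.

Definition poly_time_decidable2 (R : seq bool -> seq bool -> Prop) : Prop :=
  exists (M : tm) (k : nat), forall w u : seq bool,
    let c := tm_run M [:: w; u] (poly_bound k (size w + size u)) in
    tm_halted c /\ (tm_accept c.1 <-> R w u).

Definition language := seq bool -> Prop.

Definition in_NP (L : language) : Prop :=
  exists (R : seq bool -> seq bool -> Prop) (k : nat),
    poly_time_decidable2 R /\
    forall w, L w <-> exists2 u, size u <= poly_bound k (size w) & R w u.

Definition poly_time_reducible (L L' : language) : Prop :=
  exists2 f : seq bool -> seq bool,
    poly_time_computable f & forall w, L w <-> L' (f w).

Definition NP_hard (L : language) : Prop :=
  forall L' : language, in_NP L' -> poly_time_reducible L' L.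

Definition NP_complete (L : language) : Prop := in_NP L /\ NP_hard L.

(** * Graphs *)

Section Graphs.

Variables (T : finType) (e : rel T).

Definition simple_graph : Prop := symmetric e /\ irreflexive e.

Definition bipartite : Prop :=
  exists A : {set T}, forall x y, e x y -> (x \in A) != (y \in A).

Definition induced_P3 (x y z : T) : bool :=
  [&& e x y, e y z, x != z & ~~ e x z].

Definition P3star_convex (S : {set T}) : Prop :=
  forall x y z, induced_P3 x y z -> x \in S -> z \in S -> y \in S.

Definition has_P3star_convex_partition (p : nat) : Prop :=
  exists P : {set {set T}},
    [/\ partition P [set: T], #|P| = p
      & forall V, V \in P -> P3star_convex V /\ V != [set: T]].

End Graphs.

(* Number of vertices in unary, a separator, then the rows of the adjacency
   matrix. *)
Definition encode_graph n (e : rel 'I_n) : seq bool :=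
  nseq n true ++ false :: [seq e x y | x <- enum 'I_n, y <- enum 'I_n].

Definition graph_problem (Q : forall n, rel 'I_n -> Prop) : language :=
  fun w => exists (n : nat) (e : rel 'I_n),
    [/\ simple_graph e, w = encode_graph e & Q n e].

Definition P3star_convex_partition_problem (p : nat) : language :=
  graph_problem (fun n e => has_P3star_convex_partition e p).

(* Words that do not encode a bipartite graph are rejected. *)
Definition bipartite_P3star_convex_partition_problem (p : nat) : language :=
  graph_problem (fun n e => bipartite e /\ has_P3star_convex_partition e p).

(* Main.v *)
(* In a bipartite graph a set is convex when every vertex outside it has at most
   one neighbour in it, so that a vertex with two neighbours of one colour must
   take that colour.  Hence a complete bipartite graph with more than [p]
   vertices on one side is monochromatic and can serve as a variable, and a
   vertex joined twice to the variable [a] and once to each of [x] and [y]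
   expresses the tie constraint "if [x] and [y] have the same colour, then [a]
   has it too".  Over the two colours true and false this constraint says
   [x && y ==> a] and [a ==> x || y]; with the two constants it yields Horn
   implications and disjunctions of two variables, which is all that is needed
   to describe the run of a Turing machine on a guessed certificate in a tableau
   whose tapes move under fixed heads.  The other [p - 2] colours are kept apart
   from these two by further tie constraints.

   Polynomial time is obtained from a language of arithmetic expressions with
   bounded sums: each of them is computed by a multi-tape machine that stores
   numbers as head positions, in time polynomial in the input length.  Both the
   verifier and the adjacency matrix of the constructed graph are given by such
   expressions. *)
Require Import Defs.
From mathcomp Require Import all_boot.
From mathcomp Require Import zify.
From Stdlib Require Import FunctionalExtensionality.

Set Implicit Arguments.
Unset Strict Implicit.
Unset Printing Implicit Defensive.

(** * Programs on tapes *)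

(** A constant colouring satisfies every tie constraint, so constraints alone cannot tell true from
    false. What breaks the symmetry is that all [p >= 2] classes must be nonempty: once every colour
    occurs, the constraints with premises true and false keep these two apart, a palette of [p]
    differently coloured variables exhausts the colours, and a variable that avoids the additional
    palette colours is two-valued.

    A tie constraint is also stronger than a Horn clause, because two false premises give a false
    conclusion. Hence the conjunction of two variables gets a variable of its own, fed by a single
    constraint, and a variable with several sources, such as the content of a cell, is fed only by
    constraints having the constant true as one premise.

    The tableau asserts only which facts must be true. A satisfying assignment may make further
    facts true, and acceptance is imposed by forbidding the nonaccepting states in the last row. No
    uniqueness of states or symbols has to be expressed. *)

Notation sym := (symbol unit).

Definition mark : sym := Some (inr tt).

Definition bit (b : bool) : sym := Some (inl b).

(** A machine that moves leaves explicit blanks at the ends of its lists, so one tape content has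
    many representations. Dropping outer blanks makes the representation unique, and program states
    can be compared by plain equality. *)
Definition push (a : sym) (l : seq sym) : seq sym :=
  if (a, l) is (None, [::]) then [::] else a :: l.

Definition strip (l : seq sym) : seq sym := foldr push [::] l.

Definition normalize (t : tape unit) : tape unit :=
  (strip t.1.1, t.1.2, strip t.2).

Definition norm_move (m : move) (t : tape unit) : tape unit :=
  let: (l, a, r) := t in
  match m with
  | MoveLeft => (behead l, head None l, push a r)
  | MoveStay => t
  | MoveRight => (push a l, head None r, behead r)
  end.

Lemma push_behead a l : behead (push a l) = l.
Proof. by case: a l => [?|] []. Qed.

Lemma push_head a l : head None (push a l) = a.
Proof. by case: a l => [?|] []. Qed.

Lemma push_bit b l : push (bit b) l = bit b :: l.
Proof. by case: l. Qed.

Lemma normalize_move m t : normalize (tape_move m t) = norm_move m (normalize t).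
Proof.
case: t => [[l a] r]; case: m => //=; rewrite /normalize /=.
- by congr (_, _, _); case: l => //= b l; rewrite ?push_behead ?push_head.
- by congr (_, _, _); case: r => //= b r; rewrite ?push_behead ?push_head.
Qed.

Lemma normalize_write a t : normalize (tape_write a t) = tape_write a (normalize t).
Proof. by case: t => [[l b] r]. Qed.

Lemma strip_bits (w : seq bool) : strip (map bit w) = map bit w.
Proof. by elim: w => //= b w ->; case: (map _ _). Qed.

(** The hypothesis excludes exactly [r = [:: None]], which the round trip would turn into [[::]]. *)
Lemma norm_moveLR l a r : push (head None r) (behead r) = r ->
  norm_move MoveLeft (norm_move MoveRight (l, a, r)) = (l, a, r).
Proof. by rewrite /norm_move => ->; rewrite push_behead push_head. Qed.

Arguments tape_move : simpl never.
Arguments tape_write : simpl never.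
Arguments norm_move : simpl never.
Arguments normalize : simpl never.

Lemma norm_move_stay t : norm_move MoveStay t = t.
Proof. by case: t => [[]]. Qed.

Definition tapes : Type := nat -> tape unit.

Definition upd (T : Type) (s : nat -> T) (k : nat) (t : T) : nat -> T :=
  fun i => if i == k then t else s i.

Lemma upd_same (T : Type) (s : nat -> T) k t : upd s k t k = t.
Proof. by rewrite /upd eqxx. Qed.

(** * Jump programs and the machines that run them *)

Inductive instr :=
  | IMove of nat & move
  | IWrite of nat & sym
  | IJump of nat & pred sym & nat.

Definition instr_tape (i : instr) : nat :=
  match i with IMove k _ | IWrite k _ | IJump k _ _ => k end.

Section FlatCode.

Variable code : seq instr.

Notation label := 'I_(size code).+2.

Definition goto (n : nat) : label := inord n.

Definition flat_step (c : label * tapes) : label * tapes :=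
  match onth code c.1 with
  | Some (IMove k m) => (goto c.1.+1, upd c.2 k (norm_move m (c.2 k)))
  | Some (IWrite k a) => (goto c.1.+1, upd c.2 k (tape_write a (c.2 k)))
  | Some (IJump k P n) => (goto (if P (tape_read (c.2 k)) then n else c.1.+1), c.2)
  | None => c
  end.

Definition code_extra : nat := \max_(i <- code) instr_tape i.

Definition code_trans (q : label) (f : {ffun 'I_code_extra.+1 -> sym}) :
  option (label * {ffun 'I_code_extra.+1 -> sym * move}) :=
  match onth code q with
  | Some (IMove k m) =>
      Some (goto q.+1, [ffun i : 'I_code_extra.+1 => (f i, if i == k :> nat then m else MoveStay)])
  | Some (IWrite k a) =>
      Some (goto q.+1, [ffun i : 'I_code_extra.+1 =>
        (if i == k :> nat then a else f i, MoveStay)])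
  | Some (IJump k P n) =>
      Some (goto (if P (f (inord k)) then n else q.+1), [ffun i => (f i, MoveStay)])
  | None => None
  end.

(* The label [size code] is the accepting halting state, [(size code).+1] the
   rejecting one. *)
Definition code_tm : tm :=
  @TM unit label code_extra (goto 0) (fun q => q == size code :> nat) code_trans.

Definition represents (c : config code_tm) (d : label * tapes) : Prop :=
  c.1 = d.1 /\ forall i, normalize (c.2 i) = d.2 i.

Lemma tape_write_read (t : tape unit) : tape_write (tape_read t) t = t.
Proof. by case: t => [[]]. Qed.

Lemma represents_step c d : represents c d -> represents (tm_step c) (flat_step d).
Proof.
case: c d => [q T] [pc s] /= [/= eq_q eqT]; subst pc.
rewrite /tm_step /tm_next /flat_step /= /code_trans.
case E: (onth code q) => [i|]; last by split.
have lt_i : instr_tape i < code_extra.+1.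
  rewrite ltnS /code_extra; move: (nat_of_ord q) E.
  elim: {q T eqT} code => [|j c IH] [|n] //=; rewrite big_cons.
    by move=> [->]; rewrite leq_maxl.
  by move=> /IH le_i; rewrite (leq_trans le_i) // leq_maxr.
have readE (k : 'I_code_extra.+1) : tape_read (T k) = tape_read (s k).
  by rewrite -eqT; case: (T k) => [[]].
case: i E lt_i => [k m|k a|k P n] E /= lt_k; split => //=.
- move=> i; rewrite !ffunE /= tape_write_read normalize_move eqT /upd.
  by case: eqP => [->|_] //; rewrite norm_move_stay.
- move=> i; rewrite !ffunE /= normalize_move norm_move_stay /upd.
  by case: eqP => [<-|_]; rewrite ?tape_write_read ?normalize_write eqT.
- by rewrite ffunE readE inordK.
- by move=> i; rewrite !ffunE /= normalize_move norm_move_stay tape_write_read eqT.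
Qed.

Lemma represents_halted c (d : label * tapes) : represents c d -> size code <= d.1 -> tm_halted c.
Proof.
case=> eq_q _ ?; rewrite /tm_halted /tm_next /= /code_trans eq_q.
by rewrite onth_default.
Qed.

Lemma flat_step_halted n (d : label * tapes) : size code <= d.1 -> iter n flat_step d = d.
Proof. by move=> ?; elim: n => //= n ->; rewrite /flat_step onth_default. Qed.

Definition start_tapes (ws : seq (seq bool)) : tapes :=
  fun i => tape_of_bits unit (nth [::] ws i).

Lemma represents_init ws : represents (tm_init code_tm ws) (goto 0, start_tapes ws).
Proof.
split=> //= i; rewrite ffunE /normalize /start_tapes /tape_of_bits /=.
by case: (nth _ _ _) => //= b w; rewrite -/bit strip_bits.
Qed.

(** Polynomial time is defined by looking at the machine at one prescribed time [t]; since a halting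
    label is a fixed point of the step, stopping at any [t' <= t] is enough. *)
Lemma code_tm_run ws t t' (q : label) s :
  iter t' flat_step (goto 0, start_tapes ws) = (q, s) -> size code <= q -> t' <= t ->
  let c := tm_run code_tm ws t in
  [/\ tm_halted c, c.1 = q & forall i, normalize (c.2 i) = s i].
Proof.
move=> run_t' q_halt le_t.
have run_t : iter t flat_step (goto 0, start_tapes ws) = (q, s).
  by rewrite -(subnK le_t) iterD run_t' flat_step_halted.
have repr : represents (tm_run code_tm ws t) (q, s).
  rewrite -run_t /tm_run; elim: (t) => [|n IH] /=; first exact: represents_init.
  exact: represents_step.
move=> c; split; [exact: represents_halted repr _|by case: repr|by case: repr].
Qed.

End FlatCode.

(** * Structured programs and their compilation *)

Inductive cmd :=
  | Skip
  | Move of nat & move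
  | Write of nat & sym
  | Seq of cmd & cmd
  | If of nat & pred sym & cmd & cmd
  | While of nat & pred sym & cmd.

Notation "c1 ;; c2" := (Seq c1 c2) (at level 60, right associativity).

(* The last argument is an upper bound on the running time. *)
Inductive exec : cmd -> tapes -> tapes -> nat -> Prop :=
  | ExecSkip s t : exec Skip s s t
  | ExecMove k m s s' t : 0 < t -> s' = upd s k (norm_move m (s k)) ->
      exec (Move k m) s s' t
  | ExecWrite k a s s' t : 0 < t -> s' = upd s k (tape_write a (s k)) ->
      exec (Write k a) s s' t
  | ExecSeq c1 c2 s1 s2 s3 t1 t2 t : exec c1 s1 s2 t1 -> exec c2 s2 s3 t2 ->
      t1 + t2 <= t -> exec (c1 ;; c2) s1 s3 t
  | ExecIfTrue k (P : pred sym) c1 c2 s s' t1 t : P (tape_read (s k)) ->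
      exec c1 s s' t1 -> t1 + 1 <= t -> exec (If k P c1 c2) s s' t
  | ExecIfFalse k (P : pred sym) c1 c2 s s' t1 t : ~~ P (tape_read (s k)) ->
      exec c2 s s' t1 -> t1 + 2 <= t -> exec (If k P c1 c2) s s' t
  | ExecWhileEnd k (P : pred sym) c s t : ~~ P (tape_read (s k)) -> 0 < t ->
      exec (While k P c) s s t
  | ExecWhileLoop k (P : pred sym) c s1 s2 s3 t1 t2 t : P (tape_read (s1 k)) ->
      exec c s1 s2 t1 -> exec (While k P c) s2 s3 t2 -> t1 + t2 + 2 <= t ->
      exec (While k P c) s1 s3 t.

(** Jumps are absolute, so the address [o] of the first instruction is a parameter. In a conditional
    the else-branch comes first and has to jump over the then-branch; this is why [exec] charges 2
    for it and 1 for the other. *)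
Fixpoint compile (c : cmd) (o : nat) : seq instr :=
  match c with
  | Skip => [::]
  | Move k m => [:: IMove k m]
  | Write k a => [:: IWrite k a]
  | c1 ;; c2 => let p1 := compile c1 o in p1 ++ compile c2 (o + size p1)
  | If k P c1 c2 =>
      let p2 := compile c2 o.+1 in
      let o1 := (o.+1 + size p2).+1 in
      let p1 := compile c1 o1 in
      IJump k P o1 :: p2 ++ IJump k predT (o1 + size p1) :: p1
  | While k P c1 =>
      let p := compile c1 o.+1 in
      IJump k (predC P) (o.+1 + size p + 1) :: p ++ [:: IJump k predT o]
  end.

Definition located (code seg : seq instr) (o : nat) : Prop :=
  exists pre post, code = pre ++ seg ++ post /\ size pre = o.

Lemma located_cat code s1 s2 o :
  located code (s1 ++ s2) o -> located code s1 o /\ located code s2 (o + size s1).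
Proof.
move=> [pre [post [-> <-]]]; split.
- by exists pre, (s2 ++ post); rewrite -!catA.
- by exists (pre ++ s1), post; rewrite -!catA size_cat.
Qed.

Lemma located_size code seg o : located code seg o -> o + size seg <= size code.
Proof. by move=> [pre [post [-> <-]]]; rewrite !size_cat; lia. Qed.

Lemma located_cons code i seg o : located code (i :: seg) o ->
  onth code o = Some i /\ located code seg o.+1.
Proof.
rewrite -cat1s => /located_cat[[pre [post [-> <-]]]]; rewrite addn1; split=> //.
by rewrite onth_cat ltnn subnn.
Qed.

Lemma iter_trans (T : Type) (f : T -> T) x y z m n :
  iter m f x = y -> iter n f y = z -> iter (m + n) f x = z.
Proof. by move=> <- <-; rewrite addnC iterD. Qed.

Section CompileCorrect.

Variable code : seq instr.

Notation at_ n := (goto code n).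

Lemma at_val n : n <= size code -> at_ n = n :> nat.
Proof. by move=> ?; rewrite /goto inordK //; lia. Qed.

Lemma compile_correct c s s' t : exec c s s' t ->
  forall o, located code (compile c o) o ->
  exists2 t', t' <= t &
    iter t' (flat_step (code := code)) (at_ o, s) = (at_ (o + size (compile c o)), s').
Proof.
elim=> {c s s' t}.
- by move=> s t o _; exists 0 => //=; rewrite addn0.
- move=> k m s s' t t_gt0 -> o loc; exists 1 => //=.
  have [E _] := located_cons loc; have := located_size loc => /= le_o.
  by rewrite /flat_step /= at_val ?E ?addn1 //; lia.
- move=> k a s s' t t_gt0 -> o loc; exists 1 => //=.
  have [E _] := located_cons loc; have := located_size loc => /= le_o.
  by rewrite /flat_step /= at_val ?E ?addn1 //; lia.
- move=> c1 c2 s1 s2 s3 t1 t2 t _ IH1 _ IH2 le_t o /= /located_cat[loc1 loc2].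
  have [t1' le1 run1] := IH1 o loc1; have [t2' le2 run2] := IH2 _ loc2.
  exists (t1' + t2'); first by lia.
  by rewrite (iter_trans run1 run2) size_cat addnA.
- move=> k P c1 c2 s s' t1 t Ps _ IH le_t o /= loc.
  have := located_size loc; rewrite /= size_cat /= => le_o.
  have [E /located_cat[loc2 /located_cons[E2 loc1]]] := located_cons loc.
  have [t1' le1 run1] := IH _ loc1.
  exists (1 + t1'); first by lia.
  apply: (iter_trans (y := (at_ (o.+1 + size (compile c2 o.+1)).+1, s)) _).
    by rewrite /= /flat_step /= at_val ?E ?Ps //; lia.
  by rewrite run1; congr (at_ _, _); rewrite /= ?size_cat /=; lia.
- move=> k P c1 c2 s s' t1 t nPs _ IH le_t o /= loc.
  have := located_size loc; rewrite /= size_cat /= => le_o.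
  have [E /located_cat[loc2 /located_cons[E2 loc1]]] := located_cons loc.
  have [t1' le1 run1] := IH _ loc2.
  exists (1 + (t1' + 1)); first by lia.
  apply: (iter_trans (y := (at_ o.+1, s)) _).
    by rewrite /= /flat_step /= at_val ?E ?(negPf nPs) //; lia.
  apply: (iter_trans run1).
  by rewrite /= /flat_step /= at_val ?E2 /=; [congr (at_ _, _); rewrite /= ?size_cat /=; lia|lia].
- move=> k P c s t nPs t_gt0 o /= loc; exists 1 => //=.
  have := located_size loc; rewrite /= size_cat /= => le_o.
  have [E _] := located_cons loc.
  by rewrite /flat_step /= at_val ?E /= ?nPs; [congr (at_ _, _); rewrite /= ?size_cat /=; lia|lia].
- move=> k P c s1 s2 s3 t1 t2 t Ps _ IH1 _ IH2 le_t o /= loc.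
  have := located_size loc; rewrite /= size_cat /= => le_o.
  have [t2' le2 run2] := IH2 o loc.
  have [E /located_cat[loc1 /located_cons[E2 _]]] := located_cons loc.
  have [t1' le1 run1] := IH1 _ loc1.
  exists (1 + (t1' + (1 + t2'))); first by lia.
  apply: (iter_trans (y := (at_ o.+1, s1)) _).
    by rewrite /= /flat_step /= at_val ?E /= ?Ps //; lia.
  rewrite /= size_cat in run2.
  apply: (iter_trans run1); apply: (iter_trans (y := (at_ o, s2)) _ run2).
  by rewrite /= /flat_step /= at_val ?E2 //; lia.
Qed.

End CompileCorrect.

(** * Numbers and words as head positions *)

Definition blank : tape unit := ([::], None, [::]).

(** The mark stays at the origin and the number is the distance of the head from it, so that
    increment, decrement and the test for zero take one instruction each. *)
Definition ctr (n : nat) : tape unit := iter n (norm_move MoveRight) ([::], mark, [::]).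

Definition word_tape (w : seq bool) (n : nat) : tape unit :=
  iter n (norm_move MoveRight) (tape_of_bits unit w).

Lemma ctrS n : norm_move MoveRight (ctr n) = ctr n.+1.
Proof. by []. Qed.

Lemma ctr_shape n : exists l, ctr n = (l, if n == 0 then mark else None, [::]).
Proof.
elim: n => [|n [l E]] /=; first by exists [::].
by rewrite E; exists (push (if n == 0 then mark else None) l).
Qed.

Lemma ctr_dec n : norm_move MoveLeft (ctr n.+1) = ctr n.
Proof. by have [l E] := ctr_shape n; rewrite -ctrS E norm_moveLR. Qed.

Lemma ctr_read n : tape_read (ctr n) = if n == 0 then mark else None.
Proof. by have [l ->] := ctr_shape n. Qed.

Lemma word_tapeS w n : norm_move MoveRight (word_tape w n) = word_tape w n.+1.
Proof. by []. Qed.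

Lemma word_tape_shape w n :
  exists l, word_tape w n = (l, nth None (map bit w) n, drop n.+1 (map bit w)).
Proof.
elim: n => [|n [l E]].
  by exists [::]; rewrite /word_tape /= /tape_of_bits -/bit; case: w => //= b w; rewrite drop0.
rewrite -word_tapeS E /norm_move; eexists; congr (_, _, _).
  by rewrite -nth0 nth_drop addn0.
by rewrite -drop1 drop_drop.
Qed.

Lemma word_tape_left w n : norm_move MoveLeft (word_tape w n.+1) = word_tape w n.
Proof.
have [l E] := word_tape_shape w n; rewrite -word_tapeS E norm_moveLR //.
rewrite -map_drop; case: (drop _ _) => //= b ?; exact: push_bit.
Qed.

(* Positions beyond the word read as [2]. *)
Definition bit_at (w : seq bool) (n : nat) : nat :=
  if n < size w then nth false w n : nat else 2.

Lemma word_tape_read w n :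
  tape_read (word_tape w n) = nth None [:: bit false; bit true] (bit_at w n).
Proof.
have [l ->] := word_tape_shape w n; rewrite /tape_read /= /bit_at.
case: ltnP => n_w; last by rewrite nth_default ?size_map.
by rewrite (nth_map false) //; case: (nth _ _ _).
Qed.

Definition Inc k := Move k MoveRight.

(** The decrement precedes [c], so the body sees the values from [n - 1] down to 0 on tape [k]; the
    loop counter can thus serve as an index inside the body. *)
Definition For (k : nat) (c : cmd) : cmd :=
  While k (predC1 mark) (Move k MoveLeft ;; c).

(* [F i] is the state in which [i] iterations remain. *)
Lemma exec_For k c (F : nat -> tapes) n tb t :
  (forall i, i <= n -> F i k = ctr i) ->
  (forall i, i < n -> exec c (upd (F i.+1) k (ctr i)) (F i) tb) ->
  n * (tb + 3) + 1 <= t -> exec (For k c) (F n) (F 0) t.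
Proof.
elim: n t => [|n IH] t Fk Fc le_t.
  by apply: ExecWhileEnd; [rewrite /= Fk // ctr_read|lia].
apply: (ExecWhileLoop (s2 := F n) (t1 := tb + 1) (t2 := n * (tb + 3) + 1)).
- by rewrite /= Fk // ctr_read.
- apply: (ExecSeq (t1 := 1) (t2 := tb)); [by constructor| |by lia].
  by rewrite Fk // ctr_dec; apply: Fc.
- by apply: IH => // i lt_i; [apply: Fk|apply: Fc]; lia.
- by lia.
Qed.

(** * Arithmetic expressions with bounded sums and their evaluation on tapes *)

Inductive expr :=
  | EVar of nat
  | EConst of nat
  | EAdd of expr & expr
  | ESub of expr & expr
  | ESum of expr & expr
  | EBit of bool & expr
  | ELen of bool.

Definition inputs : Type := bool -> seq bool.

Definition env : Type := nat -> nat.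

Definition scons (T : Type) (x : T) (s : nat -> T) : nat -> T :=
  fun i => if i is j.+1 then s j else x.

(* [ESum e1 e2] binds the summation index as variable 0 of [e2]. *)
Fixpoint eval (e : expr) (W : inputs) (s : env) : nat :=
  match e with
  | EVar i => s i
  | EConst n => n
  | EAdd a b => eval a W s + eval b W s
  | ESub a b => eval a W s - eval b W s
  | ESum a b => \sum_(i < eval a W s) eval b W (scons (i : nat) s)
  | EBit b a => bit_at (W b) (eval a W s)
  | ELen b => size (W b)
  end.

Section CompileExpr.

Variable wt : bool -> nat.

(* Leaves the value on tape [d]; [rho] maps variables to tapes below [d], and
   all tapes from [d] on are blank before, all tapes after [d] are blank again
   afterwards. *)
Fixpoint compile_expr (e : expr) (rho : nat -> nat) (d : nat) : cmd :=
  match e with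
  | EVar i =>
      Write d mark ;; Write d.+1 mark ;; For (rho i) (Inc d ;; Inc d.+1) ;;
      For d.+1 (Inc (rho i)) ;; Write d.+1 None
  | EConst n => Write d mark ;; iter n (fun c => Inc d ;; c) Skip
  | EAdd a b =>
      compile_expr a rho d ;; compile_expr b rho d.+1 ;;
      For d.+1 (Inc d) ;; Write d.+1 None
  | ESub a b =>
      compile_expr a rho d ;; compile_expr b rho d.+1 ;;
      For d.+1 (If d (pred1 mark) Skip (Move d MoveLeft)) ;; Write d.+1 None
  | ESum a b =>
      Write d mark ;; compile_expr a rho d.+1 ;;
      For d.+1 (compile_expr b (scons d.+1 rho) d.+2 ;;
                For d.+2 (Inc d) ;; Write d.+2 None) ;;
      Write d.+1 None
  | EBit b a =>
      compile_expr a rho d ;; Write d.+1 mark ;;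
      For d (Inc d.+1 ;; Move (wt b) MoveRight) ;;
      If (wt b) (pred1 None) (Inc d ;; Inc d)
        (If (wt b) (pred1 (bit true)) (Inc d) Skip) ;;
      For d.+1 (Move (wt b) MoveLeft) ;; Write d.+1 None
  | ELen b =>
      Write d mark ;; Write d.+1 mark ;;
      While (wt b) (predC1 None) (Move (wt b) MoveRight ;; Inc d ;; Inc d.+1) ;;
      For d.+1 (Move (wt b) MoveLeft) ;; Write d.+1 None
  end.

(** [B] bounds the variables as well as the input lengths. The index of a sum may exceed it, so the
    body is estimated with [B] enlarged by the bound on the number of summands. *)
Fixpoint value_bound (e : expr) (B : nat) : nat :=
  match e with
  | EVar i => B
  | EConst n => n
  | EAdd a b => value_bound a B + value_bound b B
  | ESub a b => value_bound a B
  | ESum a b => value_bound a B * value_bound b (B + value_bound a B)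
  | EBit b a => 2
  | ELen b => B
  end.

Fixpoint time_bound (e : expr) (B : nat) : nat :=
  match e with
  | EVar i => 9 * B + 5
  | EConst n => n + 1
  | EAdd a b => time_bound a B + time_bound b B + 4 * value_bound b B + 2
  | ESub a b => time_bound a B + time_bound b B + 6 * value_bound b B + 2
  | ESum a b =>
      time_bound a B +
      value_bound a B * (time_bound b (B + value_bound a B) +
                         4 * value_bound b (B + value_bound a B) + 5) + 3
  | EBit b a => time_bound a B + 9 * value_bound a B + 9
  | ELen b => 9 * B + 5
  end.

Lemma value_boundP e W s B : (forall i, s i <= B) -> (forall b, size (W b) <= B) ->
  eval e W s <= value_bound e B.
Proof.
elim: e s B => //=.
- by move=> a IHa b IHb s B sB WB; rewrite leq_add ?IHa ?IHb.
- by move=> a IHa b IHb s B sB WB; rewrite (leq_trans (leq_subr _ _)) ?IHa.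
- move=> a IHa b IHb s B sB WB; have le_a := IHa s B sB WB.
  apply: (@leq_trans (\sum_(i < eval a W s) value_bound b (B + value_bound a B))).
    apply: leq_sum => i _; apply: IHb => [[|j] /=|c].
    - by have := ltn_ord i; lia.
    - by have := sB j; lia.
    - by have := WB c; lia.
  by rewrite sum_nat_const card_ord leq_mul2r le_a orbT.
- by move=> b e _ s B _ _; rewrite /bit_at; case: ifP => // _; case: nth.
Qed.

Record ready (s : tapes) (rho : nat -> nat) (d : nat) (v : env) (W : inputs) : Prop :=
  Ready {
    ready_wt : forall b, wt b < d;
    ready_word : forall b, s (wt b) = word_tape (W b) 0;
    ready_rho : forall i, rho i < d;
    ready_neq : forall i b, rho i <> wt b;
    ready_var : forall i, s (rho i) = ctr (v i);
    ready_blank : forall k, d <= k -> s k = blank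
  }.

Ltac tape_eq :=
  apply: functional_extensionality => ?; rewrite /upd;
  repeat (case: eqP => ?); subst; try lia; try congruence;
  rewrite ?subn0 ?subnn ?ctrS ?ctr_dec ?word_tapeS ?word_tape_left //; try (congr ctr; lia);
  try (congr word_tape; lia); try congruence.

Lemma exec_alloc s k : s k = blank -> exec (Write k mark) s (upd s k (ctr 0)) 1.
Proof. by move=> E; constructor; rewrite // E. Qed.

Lemma exec_free s k : s k = ctr 0 -> exec (Write k None) s (upd s k blank) 1.
Proof. by move=> E; constructor; rewrite // E. Qed.

Lemma exec_eq c s s1 s2 t : exec c s s1 t -> s1 = s2 -> exec c s s2 t.
Proof. by move=> ? <-. Qed.

Lemma exec_add s k d m n : k <> d -> s d = ctr m -> s k = ctr n ->
  exec (For k (Inc d)) s (upd (upd s d (ctr (m + n))) k (ctr 0)) (4 * n + 1).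
Proof.
move=> kd sd sk; pose F i := upd (upd s d (ctr (m + n - i))) k (ctr i).
have -> : s = F n by rewrite /F; tape_eq; rewrite addnK.
apply: exec_eq (exec_For (F := F) (tb := 1) _ _ _) _.
- by move=> i _; rewrite /F upd_same.
- by move=> i lt_i; constructor=> //; rewrite /F; tape_eq.
- by lia.
- by rewrite /F; tape_eq.
Qed.

Lemma readyS s rho d v W x : ready s rho d v W -> ready (upd s d x) rho d.+1 v W.
Proof.
case=> wt_d s_wt rho_d rho_wt s_rho s_blank.
split=> [b|b|i|//|i|k lt_k].
- by have := wt_d b; lia.
- by rewrite /upd ltn_eqF.
- by have := rho_d i; lia.
- by rewrite /upd ltn_eqF.
- by rewrite /upd gtn_eqF // s_blank // ltnW.
Qed.

Lemma compile_exprP e rho d s v W B : ready s rho d v W ->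
  (forall i, v i <= B) -> (forall b, size (W b) <= B) ->
  exec (compile_expr e rho d) s (upd s d (ctr (eval e W v))) (time_bound e B).
Proof.
elim: e rho d s v B => [x|n|a IHa b IHb|a IHa b IHb|a IHa b IHb|c a IHa|c]
  rho d s v B rs vB WB /=; case: (rs) => wt_d s_wt rho_d rho_wt s_rho s_blank.
- have [sd sd1] : s d = blank /\ s d.+1 = blank by rewrite !s_blank.
  move: (v x) (rho x) (rho_d x) (s_rho x) (vB x) => n r r_d s_r n_B.
  (* Reading a counter drains it: [F] moves the value of tape [r] to [d] and [d.+1] simultaneously,
     and [G] restores [r] from the second copy. *)
  pose F i := upd (upd (upd s r (ctr i)) d (ctr (n - i))) d.+1 (ctr (n - i)).
  pose G i := upd (upd (upd s r (ctr (n - i))) d (ctr n)) d.+1 (ctr i).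
  apply: (ExecSeq (t1 := 1)); [exact: exec_alloc| |].
  apply: (ExecSeq (t1 := 1)); [by apply: exec_alloc; rewrite /upd gtn_eqF| |].
  apply: (ExecSeq (t1 := n * 5 + 1) (s2 := F 0)).
    have -> : upd (upd s d (ctr 0)) d.+1 (ctr 0) = F n by rewrite /F; tape_eq.
    apply: (exec_For (F := F) (tb := 2)) => // [i le_i|i lt_i].
      by rewrite /F /upd; do !case: eqP => //; lia.
    by apply: (ExecSeq (t1 := 1) (t2 := 1)) => //; constructor=> //; rewrite /F; tape_eq.
  have -> : F 0 = G n by rewrite /F /G; tape_eq.
  apply: (ExecSeq (t1 := n * 4 + 1) (s2 := G 0)).
    apply: (exec_For (F := G) (tb := 1)) => // [i le_i|i lt_i].
      by rewrite /G upd_same.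
    by constructor=> //; rewrite /G; tape_eq.
  apply: exec_eq (exec_free _) _; first by rewrite /G upd_same.
  by rewrite /G; tape_eq.
  exact: leqnn.
  exact: leqnn.
  exact: leqnn.
  by lia.
- apply: (ExecSeq (t1 := 1) (t2 := n)); [by apply: exec_alloc; rewrite s_blank| |by lia].
  suff H : forall m, exec (iter n (fun c => Inc d ;; c) Skip)
     (upd s d (ctr m)) (upd s d (ctr (m + n))) n by exact: H.
  elim: n => [|n IH] m /=; first by rewrite addn0; constructor.
  apply: (ExecSeq (t1 := 1) (t2 := n) (s2 := upd s d (ctr m.+1))) => //.
    by constructor=> //; tape_eq.
  by rewrite addnS -addSn; apply: IH.
- apply: (ExecSeq (IHa _ _ _ _ _ rs vB WB)).
    apply: (ExecSeq (IHb _ _ _ _ _ (readyS _ rs) vB WB)).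
      apply: (ExecSeq (exec_add (k := d.+1) (d := d) (m := eval a W v) (n := eval b W v) _ _ _)).
      + by lia.
      + by rewrite /upd ltn_eqF // eqxx.
      + by rewrite upd_same.
      + apply: exec_eq (exec_free _) _; first by rewrite upd_same.
        have ? := s_blank d.+1 (leqnSn d); tape_eq.
      + exact: leqnn.
    exact: leqnn.
  by have := value_boundP b vB WB; lia.
- apply: (ExecSeq (IHa _ _ _ _ _ rs vB WB)).
    apply: (ExecSeq (IHb _ _ _ _ _ (readyS _ rs) vB WB)).
      set m := eval a W v; set n := eval b W v.
      pose F i := upd (upd s d (ctr (m - (n - i)))) d.+1 (ctr i).
      apply: (ExecSeq (t1 := n * 6 + 1) (s2 := F 0)).
      + have -> : upd (upd s d (ctr m)) d.+1 (ctr n) = F n by rewrite /F subnn subn0.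
        apply: (exec_For (F := F) (tb := 3)) => // [i le_i|i lt_i].
          by rewrite /F upd_same.
        have Fd : upd (F i.+1) d.+1 (ctr i) d = ctr (m - (n - i.+1)).
          by rewrite /F /upd; do !case: eqP => //; lia.
        case: (posnP (m - (n - i.+1))) => [z|nz].
          apply: (@ExecIfTrue _ _ _ _ _ _ 0) => //; first by rewrite Fd z ctr_read.
          suff -> : upd (F i.+1) d.+1 (ctr i) = F i by constructor.
          by rewrite /F; tape_eq.
        apply: (@ExecIfFalse _ _ _ _ _ _ 1) => //; first by rewrite Fd ctr_read gtn_eqF.
        constructor=> //; rewrite Fd -(prednK nz) ctr_dec /F; tape_eq.
      + apply: exec_eq (exec_free _) _; first by rewrite /F upd_same.
        have ? := s_blank d.+1 (leqnSn d); rewrite /F subn0; tape_eq.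
      + exact: leqnn.
    exact: leqnn.
  by have := value_boundP b vB WB; lia.
- have sd : s d = blank by rewrite s_blank.
  have rs1 : ready (upd s d (ctr 0)) rho d.+1 v W by apply: readyS.
  have le_a := value_boundP a vB WB.
  apply: (ExecSeq (exec_alloc sd)).
    apply: (ExecSeq (IHa _ _ _ _ _ rs1 vB WB)).
      set n := eval a W v; have le_n : n <= _ := le_a.
      pose B' := B + value_bound a B.
      pose f i := eval b W (scons i v).
      (* The index runs downwards, so with [i] iterations left the accumulated terms are those from
         [i] to [n - 1]. Tape [d.+1] is both loop counter and summation index. *)
      pose F i := upd (upd s d (ctr (\sum_(i <= j < n) f j))) d.+1 (ctr i).
      apply: (ExecSeq (s2 := F 0) (t1 := n * (time_bound b B' + 4 * value_bound b B' + 5) + 1)).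
      + have -> : upd (upd s d (ctr 0)) d.+1 (ctr n) = F n by rewrite /F big_geq.
        apply: (exec_For (F := F) (tb := time_bound b B' + 4 * value_bound b B' + 2)).
        * by move=> i le_i; rewrite /F upd_same.
        * move=> i lt_i.
          have rs2 : ready (upd (F i.+1) d.+1 (ctr i)) (scons d.+1 rho) d.+2 (scons i v) W.
            have -> : upd (F i.+1) d.+1 (ctr i) =
                upd (upd s d (ctr (\sum_(i.+1 <= j < n) f j))) d.+1 (ctr i).
              by rewrite /F; tape_eq.
            have [wt2 s2 rho2 rho_wt2 s_rho2 blank2] := readyS (ctr i) (readyS (ctr (\sum_(i.+1 <= j < n) f j)) rs).
            split=> //.
            - by case=> [|j] /=; [lia|apply: rho2].
            - by case=> [|j] b' /=; [have := wt_d b'; lia|apply: rho_wt].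
            - by case=> [|j] /=; [rewrite upd_same|apply: s_rho2].
          have fB : f i <= value_bound b B'.
            apply: value_boundP => [[|j] /=|c]; rewrite /B'; [lia| |].
            - by have := vB j; lia.
            - by have := WB c; lia.
          apply: (ExecSeq (IHb _ _ _ _ B' rs2 _ _)).
          - by case=> [|j] /=; rewrite /B'; [lia|have := vB j; lia].
          - by move=> c; have := WB c; rewrite /B'; lia.
          - apply: (ExecSeq (exec_add (k := d.+2) (d := d) (m := \sum_(i.+1 <= j < n) f j) (n := f i) _ _ _)).
            + by lia.
            + by rewrite /F /upd; do !case: eqP => //; lia.
            + by rewrite upd_same.
            + apply: exec_eq (exec_free _) _; first by rewrite upd_same.
              rewrite /F (big_ltn lt_i) addnC.
              by have ? := s_blank d.+2 (leqW (leqnSn d)); tape_eq.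
            + exact: leqnn.
          - by lia.
        * by lia.
      + apply: exec_eq (exec_free _) _; first by rewrite /F upd_same.
        have ? := s_blank d.+1 (leqnSn d); rewrite /F big_mkord; tape_eq.
      + exact: leqnn.
    exact: leqnn.
  rewrite -/(value_bound _ _); set X := time_bound b _ + _ + _.
  by have : eval a W v * X <= value_bound a B * X; [rewrite leq_mul2r le_a orbT|lia].
- apply: (ExecSeq (IHa _ _ _ _ _ rs vB WB)).
    have le_a := value_boundP a vB WB.
    set n := eval a W v; have le_n : n <= _ := le_a.
    have sd1 : s d.+1 = blank by rewrite s_blank.
    apply: (ExecSeq (s2 := upd (upd s d (ctr n)) d.+1 (ctr 0)) (t1 := 1)).
    + by apply: exec_alloc; rewrite /upd gtn_eqF.
    + have wcd : wt c < d by []. have swt := s_wt c.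
      have wdF : (d == wt c) = false by rewrite gtn_eqF.
      have wd1F : (d.+1 == wt c) = false by rewrite gtn_eqF // ltnW.
      (* Tape [d.+1] records how far the head of the word tape has advanced, so that it can be
         rewound after the bit is read. *)
      pose F i := upd (upd (upd s d (ctr i)) d.+1 (ctr (n - i))) (wt c) (word_tape (W c) (n - i)).
      apply: (ExecSeq (s2 := F 0) (t1 := n * 5 + 1)).
      * have -> : upd (upd s d (ctr n)) d.+1 (ctr 0) = F n by rewrite /F; tape_eq.
        apply: (exec_For (F := F) (tb := 2)) => // [i le_i|i lt_i].
          by rewrite /F /upd; do !case: eqP => //; lia.
        by apply: (ExecSeq (t1 := 1) (t2 := 1)) => //; constructor=> //; rewrite /F; tape_eq.
      * pose G m i := upd (upd (upd s d (ctr m)) d.+1 (ctr i)) (wt c) (word_tape (W c) i).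
        have -> : F 0 = G 0 n by rewrite /F /G subn0.
        have Gread m i : tape_read (G m i (wt c)) = nth None [:: bit false; bit true] (bit_at (W c) i).
          by rewrite /G upd_same word_tape_read.
        have incG m : exec (Inc d) (G m n) (G m.+1 n) 1.
          by constructor=> //; rewrite /G; tape_eq.
        apply: (ExecSeq (s2 := G (bit_at (W c) n) n) (t1 := 4)).
        - move: (Gread 0 n); rewrite /bit_at; case: ifP => _.
            case: (nth false _ _) => Gr.
              apply: (@ExecIfFalse _ _ _ _ _ _ 2) => //; first by rewrite Gr.
              by apply: (@ExecIfTrue _ _ _ _ _ _ 1) => //; rewrite Gr.
            apply: (@ExecIfFalse _ _ _ _ _ _ 2) => //; first by rewrite Gr.
            by apply: (@ExecIfFalse _ _ _ _ _ _ 0) => //; [rewrite Gr|constructor].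
          move=> Gr; apply: (@ExecIfTrue _ _ _ _ _ _ 2) => //; first by rewrite Gr.
          exact: ExecSeq (incG 0) (incG 1) _.
        - apply: (ExecSeq (s2 := G (bit_at (W c) n) 0) (t1 := n * 4 + 1)).
          + apply: (exec_For (F := G (bit_at (W c) n)) (tb := 1)) => // [i le_i|i lt_i].
              by rewrite /G /upd; do !case: eqP => //; lia.
            by constructor=> //; rewrite /G; tape_eq.
          + apply: exec_eq (exec_free _) _; first by rewrite /G /upd wd1F eqxx.
            by rewrite /G; tape_eq.
          + exact: leqnn.
        - exact: leqnn.
      * exact: leqnn.
    + exact: leqnn.
  by have := value_boundP a vB WB; lia.
- have [sd sd1] : s d = blank /\ s d.+1 = blank by rewrite !s_blank.
  apply: (ExecSeq (exec_alloc sd)).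
    apply: (ExecSeq (s2 := upd (upd s d (ctr 0)) d.+1 (ctr 0)) (t1 := 1)).
    + by apply: exec_alloc; rewrite /upd gtn_eqF.
    + have wcd : wt c < d by []. have swt := s_wt c.
      have wdF : (d == wt c) = false by rewrite gtn_eqF.
      have wd1F : (d.+1 == wt c) = false by rewrite gtn_eqF // ltnW.
      pose G m i := upd (upd (upd s d (ctr m)) d.+1 (ctr i)) (wt c) (word_tape (W c) i).
      have -> : upd (upd s d (ctr 0)) d.+1 (ctr 0) = G 0 0 by rewrite /G; tape_eq.
      pose n := size (W c).
      apply: (ExecSeq (s2 := G n n) (t1 := n * 5 + 1)).
      * suff H : forall k, k <= n -> exec (While (wt c) (predC1 None)
            (Move (wt c) MoveRight;; Inc d;; Inc d.+1)) (G (n - k) (n - k)) (G n n) (k * 5 + 1).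
          by have := H n (leqnn n); rewrite subnn.
        elim=> [|k IHk] lt_k.
          rewrite subn0; apply: ExecWhileEnd => //; rewrite /G upd_same word_tape_read.
          by rewrite /bit_at ltnn.
        apply: (@ExecWhileLoop _ _ _ _ (G (n - k) (n - k)) _ 3 (k * 5 + 1)).
        - rewrite /G upd_same word_tape_read /bit_at ifT; last by rewrite /n; lia.
          by case: (nth false _ _).
        - have -> : n - k = (n - k.+1).+1 by lia.
          move: (n - k.+1) => m.
          apply: (ExecSeq (t1 := 1) (t2 := 2) (s2 := upd (G m m) (wt c) (word_tape (W c) m.+1))) => //.
            by constructor=> //; rewrite /G; tape_eq.
          by apply: (ExecSeq (t1 := 1) (t2 := 1)) => //; constructor=> //; rewrite /G; tape_eq.
        - by apply: IHk; lia.
        - by lia.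
      * apply: (ExecSeq (s2 := G n 0) (t1 := n * 4 + 1)).
        - apply: (exec_For (F := G n) (tb := 1)) => // [i le_i|i lt_i].
            by rewrite /G /upd; do !case: eqP => //; lia.
          by constructor=> //; rewrite /G; tape_eq.
        - apply: exec_eq (exec_free _) _; first by rewrite /G /upd wd1F eqxx.
          by rewrite /G; tape_eq.
        - exact: leqnn.
      * exact: leqnn.
    + exact: leqnn.
  by have := WB c; lia.
Qed.

End CompileExpr.

(** * Polynomial bounds *)

Definition poly_bounded (f : nat -> nat) : Prop :=
  exists C d, forall n, f n <= C * n.+1 ^ d.

Lemma poly_bounded_const c : poly_bounded (fun=> c).
Proof. by exists c, 0 => n; rewrite muln1. Qed.

Lemma poly_bounded_id : poly_bounded id.
Proof. by exists 1, 1 => n; rewrite mul1n expn1. Qed.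

Lemma poly_bounded_add f g :
  poly_bounded f -> poly_bounded g -> poly_bounded (fun n => f n + g n).
Proof.
move=> [C [d Hf]] [C' [d' Hg]]; exists (C + C'), (d + d') => n.
rewrite mulnDl leq_add // (leq_trans (Hf n), leq_trans (Hg n)) // leq_mul2l leq_pexp2l ?orbT //.
  exact: leq_addr.
exact: leq_addl.
Qed.

Lemma poly_bounded_mul f g :
  poly_bounded f -> poly_bounded g -> poly_bounded (fun n => f n * g n).
Proof.
move=> [C [d Hf]] [C' [d' Hg]]; exists (C * C'), (d + d') => n.
by rewrite expnD mulnACA leq_mul.
Qed.

Lemma expn_mono m n d : m <= n -> m ^ d <= n ^ d.
Proof. by case: d => // d ?; rewrite leq_exp2r. Qed.

Lemma poly_bounded_comp f g :
  poly_bounded f -> poly_bounded g -> poly_bounded (fun n => f (g n)).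
Proof.
move=> [C [d Hf]] [C' [d' Hg]]; exists (C * C'.+1 ^ d), (d' * d) => n.
rewrite (leq_trans (Hf _)) // -mulnA leq_mul2l expnM -expnMn expn_mono ?orbT //.
by rewrite mulSn addnC -addn1 leq_add // expn_gt0.
Qed.

Lemma poly_boundedP f : poly_bounded f -> exists k, forall n, f n <= poly_bound k n.
Proof.
(* The additive part [C * 2 ^ d] covers [n <= 1]. For [n >= 2] one has [C <= n ^ C] and
   [n.+1 <= n ^ 2], which gives the exponent [C + 2 * d]. *)
move=> [C [d Hf]]; exists (C + 2 * d + C * 2 ^ d) => n; rewrite /poly_bound.
apply: leq_trans (Hf n) _; case: (leqP n 1) => [n1|n2].
  have : C * n.+1 ^ d <= C * 2 ^ d by rewrite leq_mul2l expn_mono ?orbT.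
  by lia.
apply: leq_trans (leq_addr _ _).
have C_le : C <= n ^ C by rewrite (leq_trans (ltnW (ltn_expl C (ltnSn 1)))) // expn_mono.
have d_le : n.+1 ^ d <= n ^ (2 * d) by rewrite expnM expn_mono // expnS expn1; nia.
apply: leq_trans (leq_mul C_le d_le) _.
by rewrite -expnD leq_pexp2l; lia.
Qed.

Lemma poly_bound_mono k m n : m <= n -> poly_bound k m <= poly_bound k n.
Proof. by move=> ?; rewrite leq_add2r expn_mono. Qed.

Ltac poly_bounded :=
  repeat first [assumption | exact: poly_bounded_id | exact: poly_bounded_const
    | apply: poly_bounded_mul | apply: poly_bounded_add].

Lemma value_bound_poly e : poly_bounded (value_bound e).
Proof.
elim: e => [x|n|a ? b ?|a ? b ?|a ? b ?|c a ?|c] /=; poly_bounded.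
by apply: (poly_bounded_comp (f := value_bound b)); poly_bounded.
Qed.

Lemma time_bound_poly e : poly_bounded (time_bound e).
Proof.
have vb := value_bound_poly.
elim: e => [x|n|a ? b ?|a ? b ?|a ? b ?|c a ?|c] /=;
  try (have va := vb a); try (have vb' := vb b); poly_bounded.
- by apply: (poly_bounded_comp (f := time_bound b)); poly_bounded.
- by apply: (poly_bounded_comp (f := value_bound b)); poly_bounded.
Qed.

(** * Machines that decide or compute by expressions *)

Lemma start_tapesE ws i : size ws <= i -> start_tapes ws i = blank.
Proof. by move=> ?; rewrite /start_tapes nth_default. Qed.

Definition one_word (w : seq bool) : inputs := fun=> w.

Definition two_words (w u : seq bool) : inputs := fun b => if b then u else w.

Definition env0 : env := fun=> 0.

Theorem expr_decidable (e : expr) (R : seq bool -> seq bool -> Prop) :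
  (forall w u, R w u <-> eval e (two_words w u) env0 != 0) ->
  poly_time_decidable2 R.
Proof.
(* Tapes 0 and 1 carry the two words; tape 2 is a counter at zero that represents every free
   variable; the value is left on tape 3. *)
move=> eR; pose rho := fun _ : nat => 2.
pose prog := Write 2 mark ;; compile_expr nat_of_bool e rho 3.
pose p := compile prog 0.
(* On value zero the jump leads to the rejecting label [(size code).+1]; otherwise control falls
   through to the accepting label [size code]. *)
pose code := p ++ [:: IJump 3 (pred1 mark) (size p).+2].
have [k kP] : exists k, forall n, time_bound e n + 2 <= poly_bound k n.
  apply: poly_boundedP; apply: poly_bounded_add; first exact: time_bound_poly.
  exact: poly_bounded_const.
exists (code_tm code), k => w u.
pose s0 := start_tapes [:: w; u].
pose s1 := upd s0 2 (ctr 0).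
have s0_blank i : 2 <= i -> s0 i = blank by move=> ?; apply: start_tapesE.
have rs : ready nat_of_bool s1 rho 3 env0 (two_words w u).
  split=> //; first by case.
  - by case; rewrite /s1 /upd.
  - by move=> ? [].
  - by move=> i i3; rewrite /s1 /upd gtn_eqF // s0_blank // ltnW.
pose v := eval e (two_words w u) env0.
have run : exec prog s0 (upd s1 3 (ctr v)) (time_bound e (size w + size u) + 1).
  apply: (ExecSeq (exec_alloc (s0_blank 2 (leqnn 2)))).
    by apply: (compile_exprP _ (B := size w + size u) rs) => [//|[]] /=; rewrite ?leq_addr ?leq_addl.
  by rewrite addnC.
have loc : located code p 0 by exists [::], [:: IJump 3 (pred1 mark) (size p).+2].
have [t t_le run_p] := compile_correct run loc.
pose q : 'I_(size code).+2 := goto code (if v == 0 then (size p).+2 else (size p).+1).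
have size_code : size code = (size p).+1 by rewrite size_cat addn1.
have qE : q = (if v == 0 then (size p).+2 else (size p).+1) :> nat.
  by rewrite /q /goto inordK // size_code; case: ifP; lia.
have run_code : iter t.+1 (flat_step (code := code)) (goto code 0, s0) = (q, upd s1 3 (ctr v)).
  have atE : goto code (size p) = size p :> nat by rewrite at_val // size_code.
  have E : onth code (goto code (size p)) = Some (IJump 3 (pred1 mark) (size p).+2).
    by rewrite atE /code onth_cat ltnn subnn.
  rewrite iterS run_p add0n -/p /flat_step [(_, _).1]/= E [(_, _).2]/= atE.
  by rewrite upd_same ctr_read /q; case: (v == 0).
have q_halt : size code <= q by rewrite qE size_code; case: ifP; lia.
have t_le' : t.+1 <= poly_bound k (size w + size u) by apply: leq_trans (kP _); lia.
have [halted cq _] := code_tm_run run_code q_halt t_le'.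
split=> //; rewrite cq eR.
change (q == size code :> nat <-> v != 0); rewrite qE size_code.
by case: (v == 0) => /=; split=> //; rewrite ?eqxx //; lia.
Qed.

Lemma leading_bits_strip l : leading_bits (strip l) = leading_bits l.
Proof. by elim: l => //= -[[b|x]|] l IH; rewrite /push /= ?IH //; case: (strip l). Qed.

Lemma leading_bits_map w : leading_bits (map bit w) = w.
Proof. by elim: w => //= b w ->. Qed.

(** The output has to appear on tape 0, where the input stands; the input is therefore moved to tape
    1 and tape 0 is left blank. *)
Definition copy_input : cmd :=
  While 0 (predC1 None)
    (If 0 (pred1 (bit true)) (Write 1 (bit true)) (Write 1 (bit false)) ;;
     Write 0 None ;; Move 0 MoveRight ;; Move 1 MoveRight) ;;
  Move 1 MoveLeft ;; While 1 (predC1 None) (Move 1 MoveLeft) ;; Move 1 MoveRight.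

Ltac upd_eq :=
  apply: functional_extensionality => ?; rewrite /upd;
  repeat (case: eqP => ?); subst; try lia; try done.

Lemma copy_inputP s w : s 0 = tape_of_bits unit w -> s 1 = blank ->
  exec copy_input s (upd (upd s 0 blank) 1 (tape_of_bits unit w)) (11 * size w + 4).
Proof.
move=> s0 s1.
pose F w1 w2 := upd (upd s 0 (tape_of_bits unit w2)) 1 (map bit (rev w1), None, [::]).
have loop w1 w2 : exec (While 0 (predC1 None)
    (If 0 (pred1 (bit true)) (Write 1 (bit true)) (Write 1 (bit false)) ;;
     Write 0 None ;; Move 0 MoveRight ;; Move 1 MoveRight)) (F w1 w2)
     (F (w1 ++ w2) [::]) (8 * size w2 + 1).
  elim: w2 w1 => [|b w2 IH] w1; first by rewrite cats0; apply: ExecWhileEnd.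
  apply: (@ExecWhileLoop _ _ _ _ (F (rcons w1 b) w2) _ 6 (8 * size w2 + 1)).
  - by case: b.
  - pose G := upd (F w1 (b :: w2)) 1 (map bit (rev w1), bit b, [::]).
    apply: (@ExecSeq _ _ _ G _ 3 3) => //.
      case: b @G => G.
        by apply: (@ExecIfTrue _ _ _ _ _ _ 1) => //; constructor=> //; rewrite /F; upd_eq.
      by apply: (@ExecIfFalse _ _ _ _ _ _ 1) => //; constructor=> //; rewrite /F; upd_eq.
    pose G1 := upd G 0 ([::], None, map bit w2).
    apply: (@ExecSeq _ _ _ G1 _ 1 2) => //; first by constructor.
    pose G2 := upd G 0 (tape_of_bits unit w2).
    apply: (@ExecSeq _ _ _ G2 _ 1 1) => //.
      by constructor=> //; rewrite /G2 /G1; upd_eq.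
    constructor=> //; rewrite /G2 /G /F; upd_eq.
    by rewrite rev_rcons /= /norm_move push_bit.
  - by rewrite -cat_rcons; apply: IH.
  - by rewrite /=; lia.
apply: (@ExecSeq _ _ _ (F w [::]) _ (8 * size w + 1) (3 * size w + 3)); [|clear loop|by lia].
  have -> : s = F [::] w by rewrite /F; upd_eq; rewrite ?s0 ?s1.
  exact: loop.
pose H r l := upd (upd s 0 blank) 1 (behead (map bit l), head None (map bit l), map bit r).
have rewind l r : exec (While 1 (predC1 None) (Move 1 MoveLeft)) (H r l) (H (catrev l r) [::]) (3 * size l + 1).
  elim: l r => [|b l IH] r; first by apply: ExecWhileEnd.
  apply: (@ExecWhileLoop _ _ _ _ (H (b :: r) l) _ 1 (3 * size l + 1)).
  - by case: b.
  - by constructor=> //; rewrite /H; upd_eq; rewrite /norm_move push_bit.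
  - exact: IH.
  - by rewrite /=; lia.
apply: (@ExecSeq _ _ _ (H [::] (rev w)) _ 1 (3 * size w + 2)) => //; last by lia.
  by constructor=> //; rewrite /H /F; upd_eq.
have := rewind (rev w) [::]; rewrite -/(rev _) revK size_rev => run.
apply: (ExecSeq run (t2 := 1)); last by lia.
by constructor=> //; rewrite /H; upd_eq.
Qed.

Theorem expr_computable (el eb : expr) (f : seq bool -> seq bool) :
  (forall w, f w = mkseq (fun i => eval eb (one_word w) (scons i env0) != 0)
                         (eval el (one_word w) env0)) ->
  poly_time_computable f.
Proof.
move=> fE; pose wt (b : bool) := 1; pose rho := fun _ : nat => 2.
(* Since [For] counts down, the output bits are written from the last to the first while the head of
   tape 0 moves left; the final move returns it to the first bit. The inner [For 4 Skip] brings
   counter 4 back to its mark before the tape is blanked. *)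
pose prog := copy_input ;; Write 2 mark ;; compile_expr wt el rho 3 ;;
  For 3 (compile_expr wt eb (scons 3 rho) 4 ;;
         If 4 (pred1 mark) (Write 0 (bit false)) (Write 0 (bit true)) ;;
         Move 0 MoveLeft ;; For 4 Skip ;; Write 4 None) ;;
  Move 0 MoveRight.
pose vl n := value_bound el n; pose B' n := n + vl n.
pose body n := time_bound eb (B' n) + 3 * value_bound eb (B' n) + 6.
pose time n := (11 * n + 4) + time_bound el n + vl n * (body n + 3) + 9.
have [k kP] : exists k, forall n, time n <= poly_bound k n.
  have [vel veb] := (value_bound_poly el, value_bound_poly eb).
  have [tel teb] := (time_bound_poly el, time_bound_poly eb).
  have vB : poly_bounded B' by rewrite /B' /vl; poly_bounded.
  apply: poly_boundedP; rewrite /time /body /vl; poly_bounded.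
  - exact: (poly_bounded_comp (f := time_bound eb)).
  - exact: (poly_bounded_comp (f := value_bound eb)).
exists (code_tm (compile prog 0)), k => w.
set s0 := start_tapes [:: w].
have s0_blank i : 1 <= i -> s0 i = blank by move=> ?; apply: start_tapesE.
pose sc := upd (upd s0 0 blank) 1 (tape_of_bits unit w).
pose s1 := upd sc 2 (ctr 0).
have s1_blank i : 3 <= i -> s1 i = blank.
  by move=> i3; rewrite /s1 /sc /upd; do 3?[case: eqP => [|_]; first by lia]; rewrite s0_blank //; lia.
have rs : ready wt s1 rho 3 env0 (one_word w) by split=> //.
set n := eval el (one_word w) env0 in fE.
have n_le : n <= vl (size w) by apply: value_boundP.
pose out := f w.
have size_out : size out = n by rewrite /out fE size_mkseq.
pose F i := upd (upd s1 0 ([::], None, map bit (drop i out))) 3 (ctr i).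
pose sf := upd (F 0) 0 (norm_move MoveRight ([::], None, map bit out)).
have run : exec prog s0 sf (time (size w)).
  apply: (ExecSeq (copy_inputP (w := w) _ _)) => //.
    apply: (ExecSeq (s2 := s1) (t1 := 1)).
      by apply: exec_alloc; apply: s0_blank.
      apply: (ExecSeq (compile_exprP _ (B := size w) rs _ _)) => //.
        apply: (ExecSeq (s2 := F 0) (t1 := n * (body (size w) + 3) + 1) (t2 := 1)) => //.
        - have -> : upd s1 3 (ctr (eval el (one_word w) env0)) = F n.
            by rewrite /F drop_oversize ?size_out // -/n; upd_eq.
          apply: exec_For => // i lt_i.
          have -> : upd (F i.+1) 3 (ctr i) =
              upd (upd s1 3 (ctr i)) 0 ([::], None, map bit (drop i.+1 out)).
            by rewrite /F; upd_eq.
          set r := map bit _; set si := upd (upd s1 3 _) 0 _.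
          have rsi : ready wt si (scons 3 rho) 4 (scons i env0) (one_word w).
            split=> //.
            + by case.
            + by case.
            + by case.
            + by move=> j j4; rewrite /si /upd; do 2?[case: eqP => [|_]; first by lia]; rewrite s1_blank //; lia.
          set v := eval eb (one_word w) (scons i env0).
          have i_le : i <= B' (size w) by rewrite /B'; lia.
          have v_le : v <= value_bound eb (B' (size w)).
            by apply: value_boundP => [[|j]|c] //=; rewrite /B' leq_addr.
          apply: (ExecSeq (compile_exprP _ (B := B' (size w)) rsi _ _)).
          + by case.
          + by move=> ?; rewrite /B' leq_addr.
          + have outE : map bit (drop i out) = bit (v != 0) :: r.
              rewrite (drop_nth false) ?size_out // /r /=; congr (bit _ :: _).
              by rewrite /out fE nth_mkseq.
            pose G r' j := upd (upd (upd s1 3 (ctr i)) 0 r') 4 (ctr j).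
            apply: (ExecSeq (s2 := G ([::], bit (v != 0), r) v) (t1 := 3)
                (t2 := 3 * value_bound eb (B' (size w)) + 3)).
            - have -> : upd si 4 (ctr (eval eb (one_word w) (scons i env0))) = G ([::], None, r) v.
                by rewrite /si /G; upd_eq.
              case v0: (v == 0).
                apply: (@ExecIfTrue _ _ _ _ _ _ 1) => //; first by rewrite /G upd_same ctr_read v0.
                by constructor=> //; rewrite /G; upd_eq.
              apply: (@ExecIfFalse _ _ _ _ _ _ 1) => //; first by rewrite /G upd_same ctr_read v0.
              by constructor=> //; rewrite /G; upd_eq.
            - apply: (ExecSeq (s2 := G ([::], None, bit (v != 0) :: r) v) (t1 := 1)
                  (t2 := 3 * value_bound eb (B' (size w)) + 2)) => //.
                by constructor=> //; rewrite /G; upd_eq; rewrite /norm_move push_bit.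
              apply: (ExecSeq (s2 := G ([::], None, bit (v != 0) :: r) 0) (t1 := v * 3 + 1) (t2 := 1)).
              + apply: (exec_For (F := G _) (tb := 0)) => // j _.
                suff -> : upd (G ([::], None, bit (v != 0) :: r) j.+1) 4 (ctr j) =
                  G ([::], None, bit (v != 0) :: r) j by constructor.
                by rewrite /G; upd_eq.
              + apply: exec_eq (exec_free _) _; first by rewrite /G upd_same.
                have ? := s1_blank 4 isT.
                by rewrite /G /F outE; upd_eq; congruence.
              + by lia.
              + by lia.
            - exact: leqnn.
          + by rewrite /body; lia.
        - by constructor=> //; rewrite /sf /F drop0.
      exact: leqnn.
  rewrite /time; set X := body _ + 3.
  have : n * X <= vl (size w) * X by rewrite leq_mul2r n_le orbT.
  by move: (n * X) (vl (size w) * X) (time_bound el (size w)) => x y z; lia.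
have loc : located (compile prog 0) (compile prog 0) 0 by exists [::], [::]; rewrite cats0.
have [t t_le run_p] := compile_correct run loc.
have t_le' : t <= poly_bound k (size w) by apply: leq_trans (kP _).
have [] := code_tm_run run_p _ t_le'.
  by rewrite add0n at_val.
move=> halted _ /(_ ord0) E; split=> //.
move: E; set T := (tm_run _ _ _).2 _ => E; rewrite /tape_output.
have -> : leading_bits (T.1.2 :: T.2) = leading_bits ((normalize T).1.2 :: (normalize T).2).
  by rewrite /=; case: (T.1.2) => [[b|]|] //; rewrite leading_bits_strip.
rewrite E /sf upd_same -/out /norm_move /=.
by rewrite -{3}(leading_bits_map out); case: out {size_out F sf run run_p E}.
Qed.

(** * Expressible functions *)

Fixpoint rename (r : nat -> nat) (e : expr) : expr :=
  match e with
  | EVar i => EVar (r i)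
  | EConst n => EConst n
  | EAdd a b => EAdd (rename r a) (rename r b)
  | ESub a b => ESub (rename r a) (rename r b)
  | ESum a b => ESum (rename r a) (rename (scons 0 (fun i => (r i).+1)) b)
  | EBit c a => EBit c (rename r a)
  | ELen c => ELen c
  end.

Lemma eval_rename r e W s : eval (rename r e) W s = eval e W (fun i => s (r i)).
Proof.
elim: e r s => //= [a IHa b IHb|a IHa b IHb|a IHa b IHb|c a IHa] r s; rewrite ?IHa ?IHb //.
apply: eq_bigr => i _; rewrite IHb; congr (eval b W _).
by apply: functional_extensionality => -[].
Qed.

Fixpoint subst (t : nat -> expr) (e : expr) : expr :=
  match e with
  | EVar i => t i
  | EConst n => EConst n
  | EAdd a b => EAdd (subst t a) (subst t b)
  | ESub a b => ESub (subst t a) (subst t b)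
  | ESum a b => ESum (subst t a) (subst (scons (EVar 0) (fun i => rename S (t i))) b)
  | EBit c a => EBit c (subst t a)
  | ELen c => ELen c
  end.

Lemma eval_subst t e W s : eval (subst t e) W s = eval e W (fun i => eval (t i) W s).
Proof.
elim: e t s => //= [a IHa b IHb|a IHa b IHb|a IHa b IHb|c a IHa] t s; rewrite ?IHa ?IHb //.
apply: eq_bigr => i _; rewrite IHb; congr (eval b W _).
by apply: functional_extensionality => -[|j] //=; rewrite eval_rename.
Qed.

Definition expressible (f : inputs -> env -> nat) : Prop :=
  exists e, forall W s, eval e W s = f W s.

Definition tail (s : env) : env := fun i => s i.+1.

Lemma expr_ext f g : (forall W s, f W s = g W s) -> expressible f -> expressible g.
Proof. by move=> fg [e E]; exists e => W s; rewrite E fg. Qed.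

Lemma expr_var i : expressible (fun W s => s i).
Proof. by exists (EVar i). Qed.

Lemma expr_const n : expressible (fun W s => n).
Proof. by exists (EConst n). Qed.

Lemma expr_size c : expressible (fun W s => size (W c)).
Proof. by exists (ELen c). Qed.

Lemma expr_add a b : expressible a -> expressible b -> expressible (fun W s => a W s + b W s).
Proof. by move=> [e E] [e' E']; exists (EAdd e e') => W s /=; rewrite E E'. Qed.

Lemma expr_sub a b : expressible a -> expressible b -> expressible (fun W s => a W s - b W s).
Proof. by move=> [e E] [e' E']; exists (ESub e e') => W s /=; rewrite E E'. Qed.

Lemma expr_succ a : expressible a -> expressible (fun W s => (a W s).+1).
Proof. by move=> [e E]; exists (EAdd e (EConst 1)) => W s /=; rewrite E addn1. Qed.

Lemma expr_bit c a : expressible a -> expressible (fun W s => bit_at (W c) (a W s)).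
Proof. by move=> [e E]; exists (EBit c e) => W s /=; rewrite E. Qed.

Lemma expr_sum n (f : inputs -> env -> nat -> nat) : expressible n ->
  expressible (fun W s => f W (tail s) (s 0)) ->
  expressible (fun W s => \sum_(i < n W s) f W s i).
Proof.
move=> [e E] [e' E']; exists (ESum e e') => W s /=; rewrite E.
by apply: eq_bigr => i _; rewrite E'.
Qed.

Lemma big_iota n (F : nat -> nat) : \sum_(i <- iota 0 n) F i = \sum_(i < n) F i.
Proof. by rewrite -(big_mkord xpredT) /index_iota subn0. Qed.

Lemma expr_sum_iota n (f : inputs -> env -> nat -> nat) : expressible n ->
  expressible (fun W s => f W (tail s) (s 0)) ->
  expressible (fun W s => \sum_(i <- iota 0 (n W s)) f W s i).
Proof.
by move=> En Ef; apply: expr_ext (expr_sum En Ef) => W s; rewrite big_iota.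
Qed.

(** By substitution, expressibility needs to be proved only for variables as arguments and then
    holds for all expressible arguments. *)
Lemma expr_comp1 (f : inputs -> nat -> nat) a :
  expressible (fun W s => f W (s 0)) -> expressible a ->
  expressible (fun W s => f W (a W s)).
Proof.
move=> [e E] [e' E']; exists (subst (fun=> e') e) => W s.
by rewrite eval_subst E E'.
Qed.

Lemma expr_comp2 (f : inputs -> nat -> nat -> nat) a b :
  expressible (fun W s => f W (s 0) (s 1)) -> expressible a -> expressible b ->
  expressible (fun W s => f W (a W s) (b W s)).
Proof.
move=> [e E] [ea Ea] [eb Eb]; exists (subst (nth eb [:: ea]) e) => W s.
by rewrite eval_subst E /= Ea Eb.
Qed.

Lemma expr_mul a b : expressible a -> expressible b -> expressible (fun W s => a W s * b W s).
Proof.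
apply: (expr_comp2 (f := fun=> muln)).
apply: expr_ext (expr_sum (f := fun W s _ => s 1) (expr_var 0) (expr_var 2)) => W s.
by rewrite sum_nat_const card_ord.
Qed.

Lemma expr_exp a k : expressible a -> expressible (fun W s => a W s ^ k).
Proof.
move=> Ea; elim: k => [|k IH]; first exact: expr_const.
by apply: expr_ext (expr_mul Ea IH) => W s; rewrite expnS.
Qed.

Lemma expr_poly_bound k a : expressible a -> expressible (fun W s => poly_bound k (a W s)).
Proof. by move=> Ea; apply: expr_add (expr_const k); apply: expr_exp. Qed.

Lemma expr_leq a b : expressible a -> expressible b ->
  expressible (fun W s => nat_of_bool (a W s <= b W s)).
Proof.
move=> Ea Eb; apply: expr_ext (expr_sub (expr_const 1) (expr_sub Ea Eb)) => W s.
by rewrite -subn_eq0; case: (a W s - b W s).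
Qed.

Lemma expr_eq a b : expressible a -> expressible b ->
  expressible (fun W s => nat_of_bool (a W s == b W s)).
Proof.
move=> Ea Eb.
apply: expr_ext (expr_mul (expr_leq Ea Eb) (expr_leq Eb Ea)) => W s.
by rewrite eqn_leq mulnb.
Qed.

Lemma expr_not (a : inputs -> env -> bool) : expressible (fun W s => nat_of_bool (a W s)) ->
  expressible (fun W s => nat_of_bool (~~ a W s)).
Proof.
by move=> Ea; apply: expr_ext (expr_sub (expr_const 1) Ea) => W s; case: (a W s).
Qed.

Lemma expr_and (a b : inputs -> env -> bool) :
  expressible (fun W s => nat_of_bool (a W s)) ->
  expressible (fun W s => nat_of_bool (b W s)) ->
  expressible (fun W s => nat_of_bool (a W s && b W s)).
Proof. by move=> Ea Eb; apply: expr_ext (expr_mul Ea Eb) => W s; rewrite mulnb. Qed.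

Lemma expr_or (a b : inputs -> env -> bool) :
  expressible (fun W s => nat_of_bool (a W s)) ->
  expressible (fun W s => nat_of_bool (b W s)) ->
  expressible (fun W s => nat_of_bool (a W s || b W s)).
Proof.
move=> Ea Eb; apply: expr_ext (expr_not (expr_and (expr_not Ea) (expr_not Eb))) => W s.
by rewrite negb_and !negbK.
Qed.

Lemma expr_imply (a b : inputs -> env -> bool) :
  expressible (fun W s => nat_of_bool (a W s)) ->
  expressible (fun W s => nat_of_bool (b W s)) ->
  expressible (fun W s => nat_of_bool (a W s ==> b W s)).
Proof.
by move=> Ea Eb; apply: expr_ext (expr_or (expr_not Ea) Eb) => W s; rewrite implybE.
Qed.

Lemma expr_eqb (a b : inputs -> env -> bool) :
  expressible (fun W s => nat_of_bool (a W s)) ->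
  expressible (fun W s => nat_of_bool (b W s)) ->
  expressible (fun W s => nat_of_bool (a W s == b W s)).
Proof.
by move=> Ea Eb; apply: expr_ext (expr_eq Ea Eb) => W s; case: (a W s); case: (b W s).
Qed.

Lemma expr_if (c : inputs -> env -> bool) a b :
  expressible (fun W s => nat_of_bool (c W s)) -> expressible a -> expressible b ->
  expressible (fun W s => if c W s then a W s else b W s).
Proof.
move=> Ec Ea Eb.
apply: expr_ext (expr_add (expr_mul Ec Ea) (expr_mul (expr_not Ec) Eb)) => W s.
by case: (c W s); rewrite mul1n mul0n ?addn0.
Qed.

Lemma expr_has n (p : inputs -> env -> nat -> bool) : expressible n ->
  expressible (fun W s => nat_of_bool (p W (tail s) (s 0))) ->
  expressible (fun W s => nat_of_bool (has (p W s) (iota 0 (n W s)))).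
Proof.
move=> En Ep.
apply: expr_ext (expr_leq (expr_const 1)
  (expr_sum (f := fun W s i => nat_of_bool (p W s i)) En Ep)) => W s.
rewrite -(big_mkord xpredT (fun i => nat_of_bool (p W s i))) /index_iota subn0.
rewrite has_count -sum1_count [in RHS]big_mkcond /=.
by congr (nat_of_bool (0 < _)); apply: eq_bigr => i _; case: (p W s i).
Qed.

Lemma expr_all n (p : inputs -> env -> nat -> bool) : expressible n ->
  expressible (fun W s => nat_of_bool (p W (tail s) (s 0))) ->
  expressible (fun W s => nat_of_bool (all (p W s) (iota 0 (n W s)))).
Proof.
move=> En Ep.
apply: expr_ext (expr_not (expr_has (p := fun W s i => ~~ p W s i) En (expr_not Ep))) => W s.
by rewrite has_predC negbK.
Qed.

Lemma sum_indicator (n m : nat) (p : pred nat) : m <= n ->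
  (forall i, i < n -> p i = (i < m)) -> \sum_(i < n) (p i : nat) = m.
Proof.
move=> le_mn pE; rewrite -(subnKC le_mn) in pE *; rewrite big_split_ord /=.
rewrite (eq_bigr (fun=> 1)) => [|i _]; last by rewrite pE ?ltn_ord //; have := ltn_ord i; lia.
rewrite sum_nat_const card_ord muln1 big1 ?addn0 // => i _.
by rewrite pE ?ltn_add2l // ltnNge leq_addr.
Qed.

(** The quotient counts the [i < a] with [i.+1 * b <= a]. For [b = 0] this would count every [i],
    whereas [a %/ 0] is 0, so that case is split off. *)
Lemma expr_div a b : expressible a -> expressible b -> expressible (fun W s => a W s %/ b W s).
Proof.
apply: (expr_comp2 (f := fun=> divn)).
have E : expressible (fun W s => \sum_(i < s 0) (((i.+1 * s 1) <= s 0) : nat)).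
  apply: (expr_sum (f := fun W s i => nat_of_bool (i.+1 * s 1 <= s 0)) (expr_var 0)).
  exact: expr_leq (expr_mul (expr_succ (expr_var 0)) (expr_var 2)) (expr_var 1).
have H := expr_if (expr_leq (expr_var 1) (expr_const 0)) (expr_const 0) E.
apply: expr_ext H => W s; rewrite leqn0; case: eqP => [->|/eqP b0]; first by rewrite divn0.
apply: (sum_indicator (p := fun i => i.+1 * s 1 <= s 0)); first exact: leq_div.
by move=> i _; rewrite -leq_divRL ?lt0n.
Qed.

Lemma expr_mod a b : expressible a -> expressible b -> expressible (fun W s => a W s %% b W s).
Proof.
move=> Ea Eb; apply: expr_ext (expr_sub Ea (expr_mul (expr_div Ea Eb) Eb)) => W s.
by rewrite {1}(divn_eq (a W s) (b W s)) addKn.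
Qed.

Ltac expr_step :=
  match goal with
  | |- expressible (fun W s => nat_of_bool (~~ _)) => apply: expr_not
  | |- expressible (fun W s => nat_of_bool (_ && _)) => apply: expr_and
  | |- expressible (fun W s => nat_of_bool (_ || _)) => apply: expr_or
  | |- expressible (fun W s => nat_of_bool (_ ==> _)) => apply: expr_imply
  | |- expressible (fun W s => nat_of_bool (leq _ _)) => apply: expr_leq
  | |- expressible (fun W s => nat_of_bool (@eq_op (Datatypes_nat__canonical__eqtype_Equality) _ _)) =>
      apply: expr_eq
  | |- expressible (fun W s => nat_of_bool (@eq_op (Datatypes_bool__canonical__eqtype_Equality) _ _)) =>
      apply: expr_eqb
  | |- expressible (fun W s => nat_of_bool (all _ _)) => apply: expr_all
  | |- expressible (fun W s => nat_of_bool (has _ _)) => apply: expr_has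
  | |- expressible (fun W s => nat_of_bool (if _ then _ else _)) => fail 1
  | |- expressible (fun W s => if _ then _ else _) => apply: expr_if
  | |- expressible (fun W s => S _) => apply: expr_succ
  | |- expressible (fun W s => addn _ _) => apply: expr_add
  | |- expressible (fun W s => muln _ _) => apply: expr_mul
  | |- expressible (fun W s => subn _ _) => apply: expr_sub
  | |- expressible (fun W s => divn _ _) => apply: expr_div
  | |- expressible (fun W s => modn _ _) => apply: expr_mod
  | |- expressible (fun W s => bit_at _ _) => apply: expr_bit
  | |- expressible (fun W s => size _) => apply: expr_size
  | |- expressible (fun W s => poly_bound _ _) => apply: expr_poly_bound
  | |- expressible (fun W s => @bigop _ _ _ _ _) => apply: expr_sum_iota
  | |- expressible (fun W s => ?n) => apply: expr_const
  | |- expressible (fun W s => s _) => apply: expr_var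
  | |- expressible (fun W s => tail _ _) => apply: expr_var
  end.

Ltac expr := repeat expr_step.

(** * Colourings and graph encodings *)

Section Coloring.

Variables (T : finType) (e : rel T).

Lemma convex_partition_coloring p :
  has_P3star_convex_partition e p ->
  exists c : T -> nat,
    [/\ forall x, c x < p, forall i, i < p -> exists x, c x = i
      & forall x y z, induced_P3 e x y z -> c x = c z -> c y = c x].
Proof.
move=> [P [partP cardP convP]].
have /and3P[/eqP coverP tiP P0] := partP.
have blockP x : pblock P x \in P by rewrite pblock_mem // coverP inE.
have mem_block x : x \in pblock P x by rewrite mem_pblock coverP inE.
exists (fun x => index (pblock P x) (enum P)); split.
- by move=> x; rewrite -cardP cardE index_mem mem_enum.
- move=> i lt_i; have lt_i' : i < size (enum P) by rewrite -cardE cardP.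
  pose V := nth set0 (enum P) i.
  have VP : V \in P by rewrite -mem_enum mem_nth.
  have [x xV] : exists x, x \in V by apply/set0Pn; apply: contraNneq P0 => <-.
  by exists x; rewrite (def_pblock tiP VP xV) index_uniq ?enum_uniq.
- move=> x y z xyz /(congr1 (nth set0 (enum P))).
  rewrite !nth_index ?mem_enum // => eq_xz.
  congr (index _ _); apply: (def_pblock tiP (blockP x)).
  have [conv _] := convP _ (blockP x).
  by apply: conv xyz _ _; rewrite ?mem_block // eq_xz.
Qed.

(** All colours occur and there are at least two of them, hence no class is the whole vertex set. *)
Lemma coloring_convex_partition p (c : T -> nat) : 1 < p ->
  (forall x, c x < p) -> (forall i, i < p -> exists x, c x = i) ->
  (forall x y z, induced_P3 e x y z -> c x = c z -> c y = c x) ->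
  has_P3star_convex_partition e p.
Proof.
move=> p_gt1 c_lt c_onto c_conv.
pose f (i : 'I_p) := [set x | c x == i].
have f_inj : injective f.
  move=> i j fij; have [x cx] := c_onto i (ltn_ord i).
  have : x \in f i by rewrite inE cx.
  by rewrite fij inE cx => /eqP /val_inj.
exists [set f i | i : 'I_p]; split.
- apply/and3P; split.
  + apply/eqP/setP => x; rewrite inE; apply/bigcupP.
    by exists (f (Ordinal (c_lt x))); rewrite ?imset_f // inE.
  + apply/trivIsetP => _ _ /imsetP[i _ ->] /imsetP[j _ ->] ij.
    rewrite -setI_eq0; apply/eqP/setP => x; rewrite !inE; apply/negP => /andP[/eqP ci /eqP cj].
    by case/eqP: ij; congr f; apply: val_inj; rewrite /= -ci -cj.
  + apply/imsetP => -[i _ /setP fi]; have [x cx] := c_onto i (ltn_ord i).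
    by have := fi x; rewrite !inE cx eqxx.
- by rewrite card_imset // card_ord.
- move=> _ /imsetP[i _ ->]; split.
    move=> x y z xyz; rewrite !inE => /eqP cx /eqP cz.
    by rewrite (c_conv x y z) ?cx ?cz.
  have [j ij] : exists j : 'I_p, i != j.
    by case: (posnP i) => [i0|i0]; [exists (Ordinal p_gt1)|exists (Ordinal (ltnW p_gt1))];
       rewrite -val_eqE /=; lia.
  have [x cx] := c_onto j (ltn_ord j).
  apply/negP => /eqP /setP /(_ x); rewrite !inE cx eq_sym => /eqP /val_inj eij.
  by rewrite eij eqxx in ij.
Qed.

End Coloring.

Lemma nth_allpairs_const (A B C : Type) (f : A -> B -> C) a0 b0 c0 s t i j :
  i < size s -> j < size t ->
  nth c0 [seq f x y | x <- s, y <- t] (i * size t + j) = f (nth a0 s i) (nth b0 t j).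
Proof.
elim: s i => //= x s IH [|i] lt_i lt_j; rewrite nth_cat size_map.
  by rewrite lt_j (nth_map b0).
by rewrite mulSn -addnA ltnNge leq_addr /= addKn IH.
Qed.

(** This is the form needed for expressions, which access words only by length and single
    positions. *)
Lemma encode_graphP n (e : rel 'I_n) w :
  (w = encode_graph e) <->
  [/\ size w = n + 1 + n * n, forall i, i < n -> nth false w i,
      nth false w n = false &
      forall x y : 'I_n, nth false w (n + 1 + x * n + y) = e x y].
Proof.
have size_enc : size (encode_graph e) = n + 1 + n * n.
  by rewrite /encode_graph size_cat size_nseq /= size_allpairs size_enum_ord addn1 addSnnS.
have nth1 i : i < n -> nth false (encode_graph e) i = true.
  by move=> lt_i; rewrite nth_cat size_nseq lt_i nth_nseq lt_i.
have nth2 : nth false (encode_graph e) n = false.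
  by rewrite nth_cat size_nseq ltnn subnn.
have nth3 (x y : 'I_n) : nth false (encode_graph e) (n + 1 + x * n + y) = e x y.
  rewrite nth_cat size_nseq ifF; last by lia.
  have -> : n + 1 + x * n + y - n = (x * n + y).+1 by lia.
  have := nth_allpairs_const e x x false (s := enum 'I_n) (t := enum 'I_n) (i := x) (j := y).
  by rewrite size_enum_ord !nth_ord_enum /= => ->.
split=> [->|[sz h1 h2 h3]]; first by split=> // i; apply: nth1.
apply: (@eq_from_nth _ false); rewrite ?size_enc // sz => i lt_i.
case: (ltngtP i n) => [lt_in|gt_in|->]; rewrite ?h2 ?nth2 //.
  by rewrite h1 ?nth1.
have n_gt0 : 0 < n by case: (posnP n) lt_i gt_in => // ->; lia.
have lt_q : i - n - 1 < n * n by lia.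
have lt_x : (i - n - 1) %/ n < n by rewrite ltn_divLR.
have lt_y : (i - n - 1) %% n < n by rewrite ltn_mod.
have -> : i = n + 1 + Ordinal lt_x * n + Ordinal lt_y.
  by rewrite /= -addnA -divn_eq; lia.
by rewrite h3 nth3.
Qed.

(** This is the length of the leading block of ones, written as a bounded sum so that it is
    expressible. *)
Definition unary_prefix (w : seq bool) : nat :=
  \sum_(i <- iota 0 (size w)) (all (fun j => bit_at w j == 1) (iota 0 i.+1) : nat).

Lemma bit_at1 w i : (bit_at w i == 1) = nth false w i.
Proof.
by rewrite /bit_at; case: ltnP => [_|le_w]; [case: nth|rewrite nth_default].
Qed.

Lemma unary_prefixE w n : n < size w -> (forall i, i < n -> nth false w i) ->
  nth false w n = false -> unary_prefix w = n.
Proof.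
move=> lt_n w1 w0; rewrite /unary_prefix big_iota.
apply: (sum_indicator (p := fun i => all (fun j => bit_at w j == 1) (iota 0 i.+1))).
  exact: ltnW.
move=> i _; apply/idP/idP => [/allP H|lt_i].
  rewrite ltnNge; apply/negP => le_ni; have := H n; rewrite mem_iota bit_at1 w0.
  by move/(_ le_ni).
by apply/allP => j; rewrite mem_iota bit_at1 => /andP[_ ?]; apply: w1; lia.
Qed.

Lemma unary_prefix_le w : unary_prefix w <= size w.
Proof.
rewrite /unary_prefix big_iota; apply: (@leq_trans (\sum_(i < size w) 1)); last by rewrite sum_nat_const card_ord muln1.
by apply: leq_sum => i _; apply: leq_b1.
Qed.

Lemma unary_prefix_nth w i : i < unary_prefix w -> nth false w i.
Proof.
pose p i := all (fun j => bit_at w j == 1) (iota 0 i.+1).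
case E : (all (fun j => bit_at w j == 1) (iota 0 (size w))).
  move=> lt_i; have lt_w := leq_trans lt_i (unary_prefix_le w).
  by have /allP /(_ i) := E; rewrite mem_iota bit_at1; apply.
move/negbT: E; rewrite -has_predC => /hasP[i0 _ i0P].
have [n /= nP n_min] : exists2 n, ~~ nth false w n & forall i, i < n -> nth false w i.
  have ex : exists n, ~~ nth false w n by exists i0; rewrite -bit_at1.
  exists (ex_minn ex); case: ex_minnP => // m mP m_min j lt_j.
  by apply: contraLR lt_j => /m_min; rewrite -leqNgt.
case: (ltnP n (size w)) => [lt_n|le_n]; first by rewrite (unary_prefixE lt_n n_min (negbTE nP)); apply: n_min.
move=> lt_i; apply: n_min; apply: leq_trans lt_i (leq_trans (unary_prefix_le w) le_n).
Qed.

(** * Membership in NP *)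

Definition adj_at (w : seq bool) (x y : nat) : bool :=
  let n := unary_prefix w in bit_at w (n + 1 + x * n + y) == 1.

(* A certificate lists the [p] classes as bit vectors, followed by one side of a
   bipartition as row [p]. *)
Definition in_class (w u : seq bool) (c x : nat) : bool :=
  bit_at u (c * unary_prefix w + x) == 1.

Definition verifier (p : nat) (bip : bool) (w u : seq bool) : bool :=
  let V := iota 0 (unary_prefix w) in
  let C := iota 0 p in
  [&& size w == unary_prefix w + 1 + unary_prefix w * unary_prefix w,
      bit_at w (unary_prefix w) == 0,
      all (fun x => ~~ adj_at w x x) V,
      all (fun x => all (fun y => adj_at w x y == adj_at w y x) V) V,
      all (fun x => \sum_(c <- C) in_class w u c x == 1) V,
      all (fun c => has (in_class w u c) V) C,
      all (fun c => all (fun x => all (fun y => all (fun z =>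
        [&& in_class w u c x, in_class w u c z, x != z,
            adj_at w x y, adj_at w y z & ~~ adj_at w x z] ==> in_class w u c y) V) V) V) C
    & bip ==> all (fun x => all (fun y =>
        adj_at w x y ==> ~~ (in_class w u p x == in_class w u p y)) V) V].

Lemma expr_unary_prefix : expressible (fun W s => unary_prefix (W false)).
Proof. by rewrite /unary_prefix; expr. Qed.

Lemma expr_adj_at a b : expressible a -> expressible b ->
  expressible (fun W s => adj_at (W false) (a W s) (b W s)).
Proof.
apply: (expr_comp2 (f := fun W x y => adj_at (W false) x y : nat)).
by rewrite /adj_at; expr; exact: expr_unary_prefix.
Qed.

Lemma expr_in_class a b : expressible a -> expressible b ->
  expressible (fun W s => in_class (W false) (W true) (a W s) (b W s)).
Proof.
apply: (expr_comp2 (f := fun W c x => in_class (W false) (W true) c x : nat)).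
by rewrite /in_class; expr; exact: expr_unary_prefix.
Qed.

Ltac expr_graph := repeat first [expr_step | exact: expr_unary_prefix
  | apply: expr_adj_at | apply: expr_in_class].

Lemma expr_verifier p bip :
  expressible (fun W s => verifier p bip (W false) (W true)).
Proof. by rewrite /verifier; expr_graph. Qed.

Lemma adj_at_encode n (e : rel 'I_n) (x y : 'I_n) :
  adj_at (encode_graph e) x y = e x y.
Proof.
have [sz w1 w0 we] := (encode_graphP e (encode_graph e)).1 erefl.
by rewrite /adj_at (unary_prefixE _ w1 w0) ?bit_at1 ?we // sz; lia.
Qed.

Lemma unary_prefix_encode n (e : rel 'I_n) : unary_prefix (encode_graph e) = n.
Proof.
have [sz w1 w0 we] := (encode_graphP e (encode_graph e)).1 erefl.
by rewrite (unary_prefixE _ w1 w0) // sz; lia.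
Qed.

Lemma all_iotaP n (P : pred nat) :
  reflect (forall x : 'I_n, P x) (all P (iota 0 n)).
Proof.
apply: (iffP allP) => [H x|H x]; first by apply: H; rewrite mem_iota ltn_ord.
by rewrite mem_iota => /andP[_ lt_x]; apply: (H (Ordinal lt_x)).
Qed.

Lemma verifier_sound p bip w u : 1 < p -> verifier p bip w u ->
  exists n (e : rel 'I_n), [/\ simple_graph e, w = encode_graph e &
    (bip -> bipartite e) /\ has_P3star_convex_partition e p].
Proof.
move=> p_gt1; set n := unary_prefix w.
case/and4P=> /eqP sz w0 irr /and5P[sym part onto conv bipart].
pose e (x y : 'I_n) := adj_at w x y.
have e_sym : symmetric e.
  by move=> x y; move/all_iotaP: sym => /(_ x) /all_iotaP /(_ y) /eqP.
exists n, e; split.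
- by split=> // x; apply/negbTE; move/all_iotaP: irr; apply.
- apply/encode_graphP; split=> //.
  + by move=> i; apply: unary_prefix_nth.
  + by move: w0; rewrite /bit_at; case: ifP => [_|]; [case: (nth false w n)|].
  + by move=> x y; rewrite -bit_at1.
pose cl c (x : 'I_n) := in_class w u c x.
have cl_ex x : exists2 c : 'I_p, cl c x & forall d : 'I_p, cl d x -> d = c.
  move/all_iotaP: part => /(_ x); rewrite big_iota => /eqP /= sum1.
  have [c cx] : exists c : 'I_p, cl c x.
    apply/existsP; apply: contra_eqT sum1 => /existsPn cl0.
    by rewrite big1 // => c _; have /negbTE := cl0 c; rewrite /cl => ->.
  exists c => // d dx; apply/eqP; apply: contra_eqT sum1 => dc.
  rewrite (bigD1 c) //= (bigD1 d) //=; move: cx dx; rewrite /cl => -> ->.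
  by lia.
have [col colP col_uniq] := fin_all_exists2 cl_ex.
split.
- move=> bipT; exists [set x : 'I_n | in_class w u p x] => x y exy; rewrite !inE.
  by move: bipart; rewrite bipT => /all_iotaP /(_ x) /all_iotaP /(_ y) /implyP; apply.
apply: (coloring_convex_partition (c := fun x => col x)) => //.
- move=> i lt_i; move/all_iotaP: onto => /(_ (Ordinal lt_i)) /hasP[x].
  rewrite mem_iota => /andP[_ lt_x] /= cx; exists (Ordinal lt_x).
  by rewrite -(col_uniq _ (Ordinal lt_i)).
- move=> x y z /and4P[xy yz nxz nadj] /val_inj eq_xz; congr val.
  symmetry; apply: col_uniq.
  move/all_iotaP: conv => /(_ (col x)) /all_iotaP /(_ x) /all_iotaP /(_ y) /all_iotaP /(_ z).
  move/implyP; apply; rewrite -/(cl _ _) colP -/(cl _ _) eq_xz colP /=.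
  by apply/and4P; split.
Qed.

Lemma verifier_complete p (bip : bool) n (e : rel 'I_n) : simple_graph e ->
  (bip -> bipartite e) -> has_P3star_convex_partition e p ->
  exists2 u, size u <= p.+1 * n & verifier p bip (encode_graph e) u.
Proof.
move=> [e_sym e_irr] e_bip /convex_partition_coloring[c [c_lt c_onto c_conv]].
have [A AP] : exists A : {set 'I_n}, bip -> forall x y, e x y -> (x \in A) != (y \in A).
  by case: bip e_bip => [/(_ isT) [A ?]|_]; [exists A|exists set0].
pose lab (i x : nat) := if i < p then oapp (fun y => c y == i) false (insub x : option 'I_n)
                       else oapp (fun y => y \in A) false (insub x : option 'I_n).
pose u := mkseq (fun i => lab (i %/ n) (i %% n)) (p.+1 * n).
exists u; first by rewrite size_mkseq.
have in_classE i (x : 'I_n) : i <= p -> in_class (encode_graph e) u i x = if i < p then c x == i else x \in A.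
  move=> le_i; rewrite /in_class unary_prefix_encode bit_at1.
  have lt_ix : i * n + x < p.+1 * n.
    by rewrite mulSn addnC; have := ltn_ord x; have : i * n <= p * n; [rewrite leq_mul2r le_i orbT|lia].
  rewrite nth_mkseq // /lab divnMDl ?divn_small ?addn0 ?modnMDl ?modn_small ?ltn_ord //.
    by rewrite valK.
  by case: (posnP n) x {lt_ix} => // n0 []; rewrite n0.
have [sz w1 w0 we] := (encode_graphP e (encode_graph e)).1 erefl.
rewrite /verifier unary_prefix_encode; apply/and4P; split.
- by rewrite sz.
- by rewrite /bit_at w0; case: ifP => //; rewrite sz; lia.
- by apply/all_iotaP => x; rewrite adj_at_encode e_irr.
apply/and5P; split.
- by apply/all_iotaP => x; apply/all_iotaP => y; rewrite !adj_at_encode e_sym.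
- apply/all_iotaP => x; rewrite big_iota (bigD1 (Ordinal (c_lt x))) //= in_classE ?(ltnW (c_lt x)) //.
  rewrite c_lt eqxx big1 // => i; rewrite -val_eqE /= in_classE ?(ltnW (ltn_ord i)) // ltn_ord eq_sym.
  by move/negbTE ->.
- apply/all_iotaP => i; have [x cx] := c_onto i (ltn_ord i).
  apply/hasP; exists (val x); first by rewrite mem_iota ltn_ord.
  by rewrite in_classE ?(ltnW (ltn_ord i)) // ltn_ord cx.
- apply/all_iotaP => i; apply/all_iotaP => x; apply/all_iotaP => y; apply/all_iotaP => z.
  rewrite !in_classE ?(ltnW (ltn_ord i)) // ltn_ord !adj_at_encode.
  apply/implyP => /and4P[/eqP cx /eqP cz xz /and3P[xy yz nxz]].
  rewrite (c_conv x y z) ?cx ?cz //; apply/and4P; split=> //.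
- apply/implyP => bipT; apply/all_iotaP => x; apply/all_iotaP => y.
  by rewrite adj_at_encode !in_classE // ltnn; apply/implyP; apply: AP.
Qed.

Lemma bipartite_flag_in_NP (p : nat) (bip : bool) : 1 < p ->
  in_NP (graph_problem (fun n e =>
    (bip -> bipartite e) /\ has_P3star_convex_partition e p)).
Proof.
move=> p_gt1.
have [k kP] : exists k, forall n, p.+1 * n <= poly_bound k n.
  by apply: poly_boundedP; poly_bounded.
exists (fun w u => verifier p bip w u), k; split.
  have [ev evP] := expr_verifier p bip.
  apply: (expr_decidable (e := ev)) => w u.
  by rewrite evP; case: (verifier _ _ _ _).
move=> w; split.
  move=> [n [e [e_simple -> [e_bip e_part]]]].
  have [u size_u uP] := verifier_complete e_simple e_bip e_part; exists u => //.
  apply: leq_trans size_u (leq_trans (kP n) (poly_bound_mono _ _)).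
  by have [-> _ _ _] := (encode_graphP e (encode_graph e)).1 erefl; lia.
by move=> [u _ /(verifier_sound p_gt1)[n [e [? ? ?]]]]; exists n, e.
Qed.

(** * From tie constraints to bipartite graphs *)

(* A tie constraint (a; x, y) asks that [a] takes the common colour of [x] and
   [y] whenever they agree; constraint [q] is [(fa q; fx q, fy q)]. *)
Definition tie_coloring (p nv nq : nat) (fa fx fy : nat -> nat) (c : nat -> nat) : Prop :=
  [/\ forall v, v < nv -> c v < p,
      forall i, i < p -> exists2 v, v < nv & c v = i
    & forall q, q < nq -> c (fx q) = c (fy q) -> c (fa q) = c (fx q)].

(** The conclusion occupies two slots: two equally coloured neighbours transfer their colour to the
    connector, and also to the hubs of that variable. *)
Definition slot (fa fx fy : nat -> nat) (q s : nat) : nat :=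
  if s < 2 then fa q else if s == 2 then fx q else fy q.

Definition hubs (p nv : nat) : nat := nv * p.+1.

Definition vertices (p nv nq : nat) : nat := hubs p nv + 4 * nq + nq.

Definition is_port (p nv nq i : nat) : bool := hubs p nv <= i < hubs p nv + 4 * nq.

(* Vertices are numbered as [p.+1] hubs for each variable, then four ports and
   finally one connector for each constraint; ports are joined to all hubs of
   their variable and to their connector. *)
Definition gadget_half (p nv nq : nat) (fa fx fy : nat -> nat) (i j : nat) : bool :=
  is_port p nv nq j &&
  (((i < hubs p nv) &&
    (i %/ p.+1 == slot fa fx fy ((j - hubs p nv) %/ 4) ((j - hubs p nv) %% 4))) ||
   ((hubs p nv + 4 * nq <= i) && (i - (hubs p nv + 4 * nq) == (j - hubs p nv) %/ 4))).

Definition gadget (p nv nq : nat) (fa fx fy : nat -> nat) (i j : nat) : bool :=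
  gadget_half p nv nq fa fx fy i j || gadget_half p nv nq fa fx fy j i.

Section Gadget.

Variables (p nv nq : nat) (fa fx fy : nat -> nat).
Hypothesis p_gt1 : 1 < p.
Hypothesis fa_lt : forall q, q < nq -> fa q < nv.
Hypothesis fx_lt : forall q, q < nq -> fx q < nv.
Hypothesis fy_lt : forall q, q < nq -> fy q < nv.
Hypothesis fa_onto : forall v, v < nv -> exists2 q, q < nq & fa q = v.

Notation n := (vertices p nv nq).
Notation nh := (hubs p nv).
Notation adj := (gadget p nv nq fa fx fy).
Notation half := (gadget_half p nv nq fa fx fy).
Notation port_var := (slot fa fx fy).

Definition gadget_rel : rel 'I_n := fun x y => adj x y.

Lemma half_port i j : half i j -> is_port p nv nq j && ~~ is_port p nv nq i.
Proof.
rewrite /gadget_half => /andP[-> /=]; rewrite /is_port => /orP[] /andP[H _].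
  by rewrite leqNgt H.
by rewrite negb_and -leqNgt H orbT.
Qed.

Lemma gadget_simple : simple_graph gadget_rel.
Proof.
split=> [x y|x]; first by rewrite /gadget_rel /gadget orbC.
apply/negP; rewrite /gadget_rel /gadget orbb => /half_port /andP[-> //].
Qed.

Lemma gadget_bipartite : bipartite gadget_rel.
Proof.
exists [set x : 'I_n | is_port p nv nq x] => x y; rewrite !inE.
by case/orP => /half_port /andP[-> /negbTE ->].
Qed.

Definition hub v k := v * p.+1 + k.
Definition port q s := nh + (q * 4 + s).
Definition conn q := nh + 4 * nq + q.

Lemma hub_port v k q s : k < p.+1 -> q < nq -> s < 4 -> v < nv ->
  half (hub v k) (port q s) = (v == port_var q s).
Proof.
move=> lt_k lt_q lt_s lt_v.
have lt_h : hub v k < nh.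
  by rewrite /hub /hubs; have : v.+1 * p.+1 <= nv * p.+1; [rewrite leq_mul2r lt_v orbT|rewrite mulSn; lia].
rewrite /gadget_half /is_port lt_h /port leq_addr ltn_add2l addKn.
rewrite divnMDl // modnMDl (divn_small lt_s) (modn_small lt_s) addn0.
rewrite [nh + 4 * nq <= _]leqNgt (leq_trans lt_h (leq_addr _ _)) /= orbF.
rewrite /hub divnMDl // (divn_small lt_k) addn0 (_ : q * 4 + s < 4 * nq) //; lia.
Qed.

Lemma conn_port q q' s : q < nq -> q' < nq -> s < 4 ->
  half (conn q) (port q' s) = (q == q').
Proof.
move=> lt_q lt_q' lt_s.
rewrite /gadget_half /is_port /conn /port leq_addr ltn_add2l !addKn leq_addr /=.
rewrite divnMDl // modnMDl (divn_small lt_s) (modn_small lt_s) addn0.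
rewrite (_ : q' * 4 + s < 4 * nq) //=; last by lia.
by rewrite (_ : _ + _ + _ < nh = false) //; lia.
Qed.

Lemma halfP i j : i < n -> half i j -> exists q s, [/\ q < nq, s < 4, j = port q s &
  (exists v k, [/\ v < nv, k < p.+1, i = hub v k & v = port_var q s]) \/ i = conn q].
Proof.
move=> lt_i; rewrite /gadget_half => /andP[/andP[le_j lt_j] H].
set k := j - nh in H; exists (k %/ 4), (k %% 4).
have kE : k = k %/ 4 * 4 + k %% 4 by exact: divn_eq.
split; rewrite ?ltn_mod //.
- by rewrite /k; lia.
- by rewrite /port -kE /k; lia.
case/orP: H => /andP[Hi /eqP E]; last by right; rewrite /conn -E; lia.
left; exists (i %/ p.+1), (i %% p.+1); split; rewrite ?ltn_mod //.
- by rewrite ltn_divLR.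
- by rewrite /hub -divn_eq.
Qed.

(** Hubs and ports get the colour of their variable, connectors that of the conclusion. A port has
    only one connector, so an induced path through it ends at some hub of its own variable; a hub
    sees a single colour. Only paths through connectors use the constraints. *)
Lemma gadget_coloring_of_tie c : tie_coloring p nv nq fa fx fy c ->
  has_P3star_convex_partition gadget_rel p.
Proof.
case=> c_lt c_onto c_tie.
pose C i := if i < nh then c (i %/ p.+1) else
  if i < nh + 4 * nq then c (port_var ((i - nh) %/ 4) ((i - nh) %% 4))
  else c (fa (i - (nh + 4 * nq))).
have Chub v k : v < nv -> k < p.+1 -> C (hub v k) = c v.
  move=> lt_v lt_k; rewrite /C /hub divnMDl // (divn_small lt_k) addn0 ifT //.
  by rewrite /hubs; have : v.+1 * p.+1 <= nv * p.+1; [rewrite leq_mul2r lt_v orbT|rewrite mulSn; lia].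
have Cport q s : q < nq -> s < 4 -> C (port q s) = c (port_var q s).
  move=> lt_q lt_s; rewrite /C /port ltnNge leq_addr /= ltn_add2l addKn.
  rewrite divnMDl // modnMDl (divn_small lt_s) (modn_small lt_s) addn0 ifT //; lia.
have Cconn q : C (conn q) = c (fa q).
  by rewrite /C /conn ltnNge -addnA leq_addr /= addnA ltnNge leq_addr /= addKn.
have slot_lt q s : q < nq -> port_var q s < nv.
  by move=> lt_q; rewrite /slot; do 2?case: ifP => _; auto.
apply: (@coloring_convex_partition _ _ _ (fun x : 'I_n => C x)) => //.
- move=> x; rewrite /C; have := ltn_ord x; case: (ltnP x nh) => [lt_x _|le_x lt_x].
    by apply: c_lt; rewrite ltn_divLR.
  case: (ltnP x (nh + 4 * nq)) => H; first by apply/c_lt/slot_lt; rewrite ltn_divLR //; lia.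
  by apply/c_lt/fa_lt; rewrite ltn_subLR.
- move=> i /c_onto[v lt_v <-].
  have lt_h : hub v 0 < n.
    rewrite /hub /vertices /hubs addn0 -addnA; apply: ltn_addr.
    by rewrite ltn_mul2r lt_v.
  by exists (Ordinal lt_h); rewrite /= Chub.
move=> x y z /and4P[xy yz nxz _]; rewrite /gadget_rel in xy yz.
case/orP: xy => xy.
  case/orP: yz => yz; first by have /andP[_] := half_port yz; have /andP[->] := half_port xy.
  have [q [s [lt_q lt_s yE [[v [k [lt_v lt_k -> vE]]]|xE]]]] := halfP (ltn_ord x) xy.
    by rewrite yE Cport // Chub // vE.
  have [q' [s' [lt_q' lt_s' yE' [[v [k [lt_v lt_k -> vE]]]|zE]]]] := halfP (ltn_ord z) yz.
    by rewrite yE' Cport // Chub // vE => ->.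
  case/eqP: nxz; apply: val_inj; rewrite /= xE zE; congr conn.
  by move: yE'; rewrite yE /port; lia.
case/orP: yz => yz; last by have /andP[_] := half_port xy; have /andP[->] := half_port yz.
have [q [s [lt_q lt_s xE yE]]] := halfP (ltn_ord y) xy.
have [q' [s' [lt_q' lt_s' zE yE']]] := halfP (ltn_ord y) yz.
rewrite xE zE !Cport //.
case: yE => [[v [k [lt_v lt_k -> vE]]]|yE]; first by rewrite Chub // vE.
have eq_q : q' = q.
  case: yE' => [[v [k [lt_v lt_k yE' _]]]|yE']; last by move: yE'; rewrite yE /conn; lia.
  have : hub v k < nh.
    by rewrite /hub /hubs; have : v.+1 * p.+1 <= nv * p.+1; [rewrite leq_mul2r lt_v orbT|rewrite mulSn; lia].
  by rewrite -yE' yE /conn; lia.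
have nss : s != s'.
  by apply: contraNneq nxz => ss; apply/eqP/val_inj; rewrite /= xE zE eq_q ss.
(* If neither end is a port of the conclusion, the two ends are slots 2 and 3 in some order, and the
   tie constraint applies. *)
rewrite eq_q yE Cconn /slot; case: (ltnP s 2) => // s2.
case: (ltnP s' 2) => [_ -> //|s2'].
case: (s =P 2) nss => [->|s3] nss.
  by rewrite ifN ?(eq_sym s') //; apply: c_tie.
by rewrite (_ : s' == 2) => [/esym H|]; [rewrite -H c_tie|apply/eqP; lia].
Qed.

(** Every hub, port and connector turns out to have the colour of some variable; hence the colours
    used by the vertices are already used by the variables. *)
Lemma gadget_tie_of_coloring : has_P3star_convex_partition gadget_rel p ->
  exists c, tie_coloring p nv nq fa fx fy c.
Proof.
case/convex_partition_coloring => col [col_lt col_onto col_conv].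
pose C i := oapp (fun x : 'I_n => col x) 0 (insub i).
have CE (x : 'I_n) : C x = col x by rewrite /C valK.
(* Two neighbours of one vertex lie on the same side of the bipartition, so they are not adjacent
   and the path is induced. *)
have conv i j k : i < n -> j < n -> k < n -> half i j -> half k j -> i <> k -> C i = C k -> C j = C i.
  move=> lt_i lt_j lt_k ij kj ik.
  rewrite (CE (Ordinal lt_i)) (CE (Ordinal lt_j)) (CE (Ordinal lt_k)); apply: col_conv.
  have [/andP[_ ni] /andP[_ nk]] := (half_port ij, half_port kj).
  apply/and4P; split; rewrite /gadget_rel /gadget ?ij ?kj ?orbT //; first by apply/eqP => -[].
  by apply/negP => /orP[] /half_port /andP[]; rewrite ?(negbTE ni) ?(negbTE nk).
have conv' i j k : i < n -> j < n -> k < n -> half j i -> half j k -> i <> k -> C i = C k -> C j = C i.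
  move=> lt_i lt_j lt_k ij kj ik.
  rewrite (CE (Ordinal lt_i)) (CE (Ordinal lt_j)) (CE (Ordinal lt_k)); apply: col_conv.
  have [/andP[ni _] /andP[nk _]] := (half_port ij, half_port kj).
  apply/and4P; split; rewrite /gadget_rel /gadget ?ij ?kj ?orbT //; first by apply/eqP => -[].
  by apply/negP => /orP[] /half_port /andP[]; rewrite ?ni ?nk.
have hub_lt v k : v < nv -> k < p.+1 -> hub v k < n.
  move=> lt_v lt_k; rewrite /hub /vertices /hubs.
  by have : v.+1 * p.+1 <= nv * p.+1; [rewrite leq_mul2r lt_v orbT|rewrite mulSn; lia].
have port_lt q s : q < nq -> s < 4 -> port q s < n by rewrite /port /vertices; lia.
have conn_lt q : q < nq -> conn q < n by rewrite /conn /vertices; lia.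
have slot_lt q s : q < nq -> port_var q s < nv.
  by move=> lt_q; rewrite /slot; do 2?case: ifP => _; auto.
(* Among [p.+1] hubs two share a colour, and every port of [v] is adjacent to both. *)
have hub_color v : v < nv -> exists d, forall q s, q < nq -> s < 4 -> port_var q s = v -> C (port q s) = d.
  move=> lt_v; have /injectivePn[k1 [k2 k12 eqk]] : ~~ injectiveb (fun k : 'I_p.+1 =>
      Ordinal (col_lt (Ordinal (hub_lt v k lt_v (ltn_ord k))))).
    by apply/negP => /injectiveP /leq_card; rewrite !card_ord ltnn.
  have eqC : C (hub v k1) = C (hub v k2).
    have := congr1 val eqk => /=.
    by rewrite -(CE (Ordinal (hub_lt v k1 lt_v (ltn_ord k1))))
      -(CE (Ordinal (hub_lt v k2 lt_v (ltn_ord k2)))).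
  exists (C (hub v k1)) => q s lt_q lt_s sE.
  have portE k : k < p.+1 -> half (hub v k) (port q s) by move=> lt_k; rewrite hub_port // sE.
  apply: (conv _ _ (hub v k2)) eqC; [exact: (hub_lt)|exact: port_lt|exact: (hub_lt)|exact: portE|exact: portE|].
  by rewrite /hub => /addnI /val_inj E; rewrite E eqxx in k12.
pose c v := C (hub v 0).
(* Conversely, [fa_onto] provides two ports of [v], which by the previous step have equal colours
   and impose them on all hubs of [v]. *)
have hubC v k : v < nv -> k < p.+1 -> forall q s, q < nq -> s < 4 -> port_var q s = v ->
    C (hub v k) = C (port q s).
  move=> lt_v lt_k q s lt_q lt_s sE; have [d dP] := hub_color v lt_v.
  have [q0 lt_q0 q0E] := fa_onto lt_v.
  have [s0 s1] : port_var q0 0 = v /\ port_var q0 1 = v by rewrite /slot.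
  rewrite (dP q s) // -(dP q0 0) //.
  have portE t : t < 4 -> port_var q0 t = v -> half (hub v k) (port q0 t).
    by move=> lt_t tE; rewrite hub_port // tE.
  apply: (conv' _ _ (port q0 1)); [exact: port_lt|exact: (hub_lt)|exact: port_lt|exact: portE|exact: portE| |].
    by rewrite /port; lia.
  by rewrite !dP.
have hubc v k : v < nv -> k < p.+1 -> C (hub v k) = c v.
  move=> lt_v lt_k; have [q0 lt_q0 q0E] := fa_onto lt_v.
  have s0 : port_var q0 0 = v by rewrite /slot.
  by rewrite /c !(hubC v _ _ _ q0 0).
have portc q s : q < nq -> s < 4 -> C (port q s) = c (port_var q s).
  by move=> lt_q lt_s; rewrite /c (hubC _ _ _ _ q s) // slot_lt.
have connc q : q < nq -> C (conn q) = c (fa q).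
  move=> lt_q; have E0 := portc q 0 lt_q isT; have E1 := portc q 1 lt_q isT.
  rewrite (_ : fa q = port_var q 0) // -E0.
  have portE t : t < 4 -> half (conn q) (port q t) by move=> lt_t; rewrite conn_port.
  apply: (conv' _ _ (port q 1)); [exact: port_lt|exact: conn_lt|exact: port_lt|exact: portE|exact: portE| |].
    by rewrite /port; lia.
  by rewrite E0 E1.
exists c; split.
- by move=> v lt_v; rewrite /c (CE (Ordinal (hub_lt v 0 lt_v isT))).
- move=> i /col_onto[x <-]; rewrite -CE.
  have := ltn_ord x; case: (ltnP x nh) => [lt_x _|le_x lt_x].
    exists (x %/ p.+1); first by rewrite ltn_divLR.
    by rewrite -(hubc _ (x %% p.+1)) ?ltn_mod // ?ltn_divLR // /hub -divn_eq.
  case: (ltnP x (nh + 4 * nq)) => H.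
    have lt_q : (x - nh) %/ 4 < nq by rewrite ltn_divLR //; lia.
    exists (port_var ((x - nh) %/ 4) ((x - nh) %% 4)); first exact: slot_lt.
    by rewrite -portc ?ltn_mod // /port -divn_eq subnKC.
  have lt_q : x - (nh + 4 * nq) < nq by rewrite ltn_subLR.
  exists (fa (x - (nh + 4 * nq))); first exact: fa_lt.
  by rewrite -connc // /conn subnKC.
- move=> q lt_q eq_xy; have E2 := portc q 2 lt_q isT; have E3 := portc q 3 lt_q isT.
  rewrite -connc // -[fx q]/(port_var q 2) -E2.
  have portE t : t < 4 -> half (conn q) (port q t) by move=> lt_t; rewrite conn_port.
  apply: (conv' _ _ (port q 3)); [exact: port_lt|exact: conn_lt|exact: port_lt|exact: portE|exact: portE| |].
    by rewrite /port; lia.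
  by rewrite E2 E3.
Qed.

End Gadget.

(* Over the Booleans, with variable 0 true and variable 1 false, the tie
   constraint (a; x, y) says [x && y ==> a] and [a ==> x || y]. *)
Definition tie_sat (nq : nat) (fa fx fy : nat -> nat) (b : nat -> bool) : Prop :=
  [/\ b 0 = true, b 1 = false
    & forall q, q < nq -> b (fx q) = b (fy q) -> b (fa q) = b (fx q)].

(** * Reduction from [p] colours to truth values *)

Section PaletteExtension.

(* The variables [nv + j] with [j < p - 2] stand for the remaining colours:
   with [true] and [false] they form a palette.  The constraint (v; true, false)
   makes the colouring constant if true and false get the same colour, and
   (true; v, nv + j) keeps [v] different from [nv + j]. *)
Variables (p nv nq : nat) (fa fx fy : nat -> nat).

Definition pal_nv := nv + (p - 2).
Definition pal_mid := pal_nv + (p - 2) * pal_nv.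
Definition pal_nq := pal_mid + nq.
Definition pal_col q := nv + (q - pal_nv) %/ pal_nv.
Definition pal_var q := (q - pal_nv) %% pal_nv.

(** The constraint (true; v, nv + j) has two degenerate cases. For [v = 0] it would be void, so the
    conclusion becomes false. For [v = nv + j] it would give [nv + j] the colour of true, so its
    second premise becomes false. *)
Definition pal_fa q :=
  if q < pal_nv then q
  else if q < pal_mid then (if pal_var q == 0 then 1 else 0) else fa (q - pal_mid).
Definition pal_fx q :=
  if q < pal_nv then 0 else if q < pal_mid then pal_var q else fx (q - pal_mid).
Definition pal_fy q :=
  if q < pal_nv then 1
  else if q < pal_mid then (if pal_var q == pal_col q then 1 else pal_col q)
  else fy (q - pal_mid).

Hypothesis p_gt1 : 1 < p.
Hypothesis nv_gt1 : 1 < nv.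
Hypothesis fa_lt : forall q, q < nq -> fa q < nv.
Hypothesis fx_lt : forall q, q < nq -> fx q < nv.
Hypothesis fy_lt : forall q, q < nq -> fy q < nv.

Lemma pal_bounds q : q < pal_nq -> [/\ pal_fa q < pal_nv, pal_fx q < pal_nv & pal_fy q < pal_nv].
Proof.
move=> lt_q; have le_nv : nv <= pal_nv by exact: leq_addr.
rewrite /pal_fa /pal_fx /pal_fy; case: (ltnP q pal_nv) => [lt_v|le_v]; first by split; lia.
case: (ltnP q pal_mid) => [lt_m|le_m].
  have lt_var : pal_var q < pal_nv by rewrite ltn_mod; lia.
  have lt_col : pal_col q < pal_nv.
    rewrite /pal_col -[X in _ < X]/(nv + (p - 2)) ltn_add2l ltn_divLR; last by lia.
    by rewrite ltn_subLR.
  by split; repeat case: ifP => _; lia.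
have lt_q' : q - pal_mid < nq by rewrite ltn_subLR.
by split; apply: leq_trans le_nv; auto.
Qed.

Lemma pal_fa_onto v : v < pal_nv -> exists2 q, q < pal_nq & pal_fa q = v.
Proof.
move=> lt_v; exists v; last by rewrite /pal_fa lt_v.
by rewrite /pal_nq /pal_mid -addnA ltn_addr.
Qed.

Lemma pal_midP v j : v < pal_nv -> j < p - 2 ->
  let q := pal_nv + (j * pal_nv + v) in
  [/\ q < pal_nq, pal_fa q = if v == 0 then 1 else 0, pal_fx q = v
    & pal_fy q = if v == nv + j then 1 else nv + j].
Proof.
move=> lt_v lt_j q.
have lt_m : q < pal_mid.
  rewrite /q /pal_mid ltn_add2l.
  have : j.+1 * pal_nv <= (p - 2) * pal_nv by rewrite leq_mul2r lt_j orbT.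
  by rewrite mulSn; lia.
have le_v : q < pal_nv = false by rewrite ltnNge leq_addr.
have var_q : pal_var q = v by rewrite /pal_var /q addKn modnMDl modn_small.
have col_q : pal_col q = nv + j.
  by rewrite /pal_col /q addKn divnMDl ?divn_small ?addn0 //; lia.
by rewrite /pal_fa /pal_fx /pal_fy le_v lt_m var_q col_q; split=> //; apply: ltn_addr.
Qed.

(** The [p] palette variables have distinct colours and so exhaust all of them. An original variable
    differs from each [nv + j], which leaves only the colours of true and false. *)
Lemma tie_sat_of_coloring c : tie_coloring p pal_nv pal_nq pal_fa pal_fx pal_fy c ->
  exists b, tie_sat nq fa fx fy b.
Proof.
case=> c_lt c_onto c_tie; have le_nv : nv <= pal_nv by exact: leq_addr.
(* Otherwise the first block of constraints makes the colouring constant, although the colours 0 and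
   1 both occur. *)
have c01 : c 0 <> c 1.
  move=> eq01; have c0 v : v < pal_nv -> c v = c 0.
    move=> lt_v; have := c_tie v; rewrite /pal_fa /pal_fx /pal_fy lt_v; apply=> //.
    by rewrite /pal_nq /pal_mid -addnA ltn_addr.
  have [v lt_v cv] := c_onto 0 (ltnW p_gt1); have [u lt_u cu] := c_onto 1 p_gt1.
  by move: cu; rewrite c0 // -(c0 v lt_v) cv.
have neq_pal v j : v < pal_nv -> j < p - 2 -> v <> nv + j -> c v <> c (nv + j).
  move=> lt_v lt_j nvj eq_c; have [lt_q qa qx qy] := pal_midP lt_v lt_j.
  have := c_tie _ lt_q; rewrite qa qx qy (introF eqP nvj) => /(_ eq_c).
  case: eqP => [-> /esym|v0 eq0] //.
  have := pal_midP (ltnW (leq_trans nv_gt1 le_nv)) lt_j => -[lt_q' qa' qx' qy'].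
  have := c_tie _ lt_q'; rewrite qa' qx' qy' /= ifN; last by lia.
  by rewrite eq0 eq_c => /(_ erefl) E; apply: c01; rewrite eq0 eq_c E.
pose pal (i : 'I_p) := if i < 2 then (i : nat) else nv + (i - 2).
have pal_lt i : pal i < pal_nv.
  by rewrite /pal /pal_nv; case: ifP; have := ltn_ord i; lia.
have lt_j (i : 'I_p) : ~~ (i < 2) -> i - 2 < p - 2 by have := ltn_ord i; lia.
have pal_inj : injective (fun i => Ordinal (c_lt _ (pal_lt i))).
  have sym i i' : c (pal i) = c (pal i') -> i <= i' -> i = i'.
    move=> eq_c le_i; apply/eqP; rewrite -val_eqE /=; apply/negPn/negP => ni.
    move: eq_c; rewrite {2}/pal; case: (ltnP i' 2) => i'2.
      have [i0 i1] : i = 0 :> nat /\ i' = 1 :> nat by lia.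
      by rewrite i1 /pal i0.
    apply: neq_pal => //; first by apply: lt_j; rewrite -leqNgt.
    by rewrite /pal; case: ifP; lia.
  move=> i i' /(congr1 val) /= eq_c; case/orP: (leq_total i i') => [|le_i]; first exact: sym.
  by apply/esym/sym.
exists (fun v => c v == c 0); split.
- by rewrite eqxx.
- by apply/eqP => /esym.
have two v : v < nv -> c v = c 0 \/ c v = c 1.
  move=> lt_v; have lt_v' := leq_trans lt_v le_nv.
  have /codomP[i /(congr1 val) /= ci] : Ordinal (c_lt v lt_v') \in codom (fun i => Ordinal (c_lt _ (pal_lt i))).
    by apply: inj_card_onto => //; rewrite !card_ord.
  move: ci; rewrite /pal; case: (ltnP i 2) => i2.
    by case: (nat_of_ord i) i2 => [|[|]] // _ ->; [left|right].
  move=> E; case: (neq_pal v (i - 2)) => //; first by apply: lt_j; rewrite -leqNgt.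
  by lia.
move=> q lt_q; have lt_q' : pal_mid + q < pal_nq by rewrite ltn_add2l.
have := c_tie _ lt_q'; rewrite /pal_fa /pal_fx /pal_fy.
have -> : pal_mid + q < pal_nv = false by rewrite /pal_mid -addnA ltnNge leq_addr.
rewrite ltnNge leq_addr addKn /=.
have [x2 y2] := (two _ (fx_lt lt_q), two _ (fy_lt lt_q)).
have c10 : (c 1 == c 0) = false by apply/eqP => /esym.
by case: x2 y2 => -> [] -> tie; rewrite ?eqxx ?c10 // => _; rewrite tie ?eqxx ?c10.
Qed.

Lemma coloring_of_tie_sat b : tie_sat nq fa fx fy b ->
  exists c, tie_coloring p pal_nv pal_nq pal_fa pal_fx pal_fy c.
Proof.
case=> b0 b1 b_tie; have le_nv : nv <= pal_nv by exact: leq_addr.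
pose c v := if v < nv then (if b v then 0 else 1) else v - nv + 2.
have cb v : v < nv -> c v = if b v then 0 else 1 by rewrite /c => ->.
have c0 : c 0 = 0 by rewrite cb ?b0 //; lia.
have c1 : c 1 = 1 by rewrite cb ?b1.
have cpal j : c (nv + j) = j + 2 by rewrite /c ltnNge leq_addr addKn.
exists c; split.
- move=> v lt_v; rewrite /c; case: (ltnP v nv) => [_|le_v]; first by case: (b v); lia.
  by move: lt_v; rewrite /pal_nv; lia.
- move=> i lt_i; case: i lt_i => [|[|i]] lt_i; [by exists 0 => //; lia|by exists 1 => //; lia|].
  by exists (nv + i); rewrite ?cpal ?addn2 // /pal_nv ltn_add2l; lia.
- move=> q lt_q; rewrite /pal_fa /pal_fx /pal_fy.
  case: (ltnP q pal_nv) => [_|le_v]; first by rewrite c0 c1.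
  case: (ltnP q pal_mid) => [lt_m|le_m].
    case: (pal_var q =P pal_col q) => [->|ne]; first by rewrite /pal_col cpal c1; lia.
    rewrite /pal_col in ne *; rewrite cpal /c; case: (ltnP (pal_var q) nv) => lt_v.
      by case: (b _); lia.
    by move=> E; case: ne; lia.
  have lt_q' : q - pal_mid < nq by rewrite ltn_subLR.
  have := b_tie _ lt_q'; rewrite !cb ?fa_lt ?fx_lt ?fy_lt //.
  by case: (b (fx _)); case: (b (fy _)); case: (b (fa _)) => // /(_ erefl).
Qed.

End PaletteExtension.

(** * Computing the graph of a system of tie constraints *)

Definition convex_partition_language (p : nat) (bip : bool) : language :=
  graph_problem (fun n e => (bip -> bipartite e) /\ has_P3star_convex_partition e p).

(** The encoding is injective: the number of vertices is the unary prefix, and then single bits give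
    the adjacencies. *)
Lemma encode_graph_problem (Q : forall n, rel 'I_n -> Prop) n (e : rel 'I_n) :
  simple_graph e -> graph_problem Q (encode_graph e) <-> Q n e.
Proof.
move=> simple_e; split=> [[m [e' [_ E Qe']]]|]; last by exists n, e.
have mn : m = n by rewrite -(unary_prefix_encode e) E unary_prefix_encode.
subst m; suff -> : e = e' by [].
apply: functional_extensionality => x; apply: functional_extensionality => y.
by rewrite -(adj_at_encode e) E adj_at_encode.
Qed.

Definition input_expressible (f : seq bool -> nat) : Prop :=
  expressible (fun W s => f (W false)).

Definition input_expressible1 (f : seq bool -> nat -> nat) : Prop :=
  expressible (fun W s => f (W false) (s 0)).

Lemma expr_app1 f a : input_expressible1 f -> expressible a ->
  expressible (fun W s => f (W false) (a W s)).
Proof. exact: (expr_comp1 (f := fun W => f (W false))). Qed.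

Section GraphReduction.

Variables (p : nat) (bip : bool) (L : language).
Variables (nv nq : seq bool -> nat) (fa fx fy : seq bool -> nat -> nat).
Hypothesis p_gt1 : 1 < p.
Hypothesis nv_expr : input_expressible nv.
Hypothesis nq_expr : input_expressible nq.
Hypothesis fa_expr : input_expressible1 fa.
Hypothesis fx_expr : input_expressible1 fx.
Hypothesis fy_expr : input_expressible1 fy.

Let nvp w := pal_nv p (nv w).
Let nqp w := pal_nq p (nv w) (nq w).
Let fap w := pal_fa p (nv w) (fa w).
Let fxp w := pal_fx p (nv w) (fx w).
Let fyp w := pal_fy p (nv w) (fy w).

Lemma nvp_expr : input_expressible nvp.
Proof. by apply: expr_add nv_expr _; expr. Qed.

Lemma nqp_expr : input_expressible nqp.
Proof.
apply: expr_add nq_expr; apply: expr_add; first exact: nvp_expr.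
by apply: expr_mul; [expr|exact: nvp_expr].
Qed.

Ltac expr_pal := repeat first [expr_step | exact: nv_expr | exact: nvp_expr | exact: nqp_expr
  | apply: (expr_app1 fa_expr) | apply: (expr_app1 fx_expr) | apply: (expr_app1 fy_expr)].

Lemma fap_expr : input_expressible1 fap.
Proof.
rewrite /input_expressible1 /fap /pal_fa /pal_mid /pal_var /pal_nv; expr_pal.
Qed.

Lemma fxp_expr : input_expressible1 fxp.
Proof.
rewrite /input_expressible1 /fxp /pal_fx /pal_mid /pal_var /pal_nv; expr_pal.
Qed.

Lemma fyp_expr : input_expressible1 fyp.
Proof.
rewrite /input_expressible1 /fyp /pal_fy /pal_mid /pal_var /pal_col /pal_nv; expr_pal.
Qed.

Let size_graph w := vertices p (nvp w) (nqp w).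
Let graph w : rel 'I_(size_graph w) := @gadget_rel p (nvp w) (nqp w) (fap w) (fxp w) (fyp w).

Lemma size_graph_expr : input_expressible size_graph.
Proof. rewrite /input_expressible /size_graph /vertices /hubs; expr_pal. Qed.

Lemma gadget_expr a b : expressible a -> expressible b ->
  expressible (fun W s => gadget p (nvp (W false)) (nqp (W false)) (fap (W false))
     (fxp (W false)) (fyp (W false)) (a W s) (b W s)).
Proof.
apply: (expr_comp2 (f := fun W x y => gadget p (nvp (W false)) (nqp (W false)) (fap (W false))
     (fxp (W false)) (fyp (W false)) x y : nat)).
rewrite /gadget /gadget_half /is_port /slot /hubs.
by repeat first [expr_step | exact: nvp_expr | exact: nqp_expr
  | apply: (expr_app1 fap_expr) | apply: (expr_app1 fxp_expr) | apply: (expr_app1 fyp_expr)].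
Qed.

Definition graph_bit (w : seq bool) (i : nat) : nat :=
  if i < size_graph w then 1 else if i == size_graph w then 0 else
  gadget p (nvp w) (nqp w) (fap w) (fxp w) (fyp w)
    ((i - size_graph w - 1) %/ size_graph w) ((i - size_graph w - 1) %% size_graph w).

Lemma graph_bit_expr : input_expressible1 graph_bit.
Proof.
rewrite /input_expressible1 /graph_bit.
by repeat first [expr_step | exact: size_graph_expr | apply: gadget_expr].
Qed.

Lemma encode_graph_computable : poly_time_computable (fun w => encode_graph (@graph w)).
Proof.
have [el elP] : input_expressible (fun w => size_graph w + 1 + size_graph w * size_graph w).
  by rewrite /input_expressible; repeat first [expr_step | exact: size_graph_expr].
have [eb ebP] := graph_bit_expr.
apply: (expr_computable (el := el) (eb := eb)) => w; symmetry.
rewrite elP; apply/encode_graphP; rewrite /one_word size_mkseq.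
have nthE i : i < size_graph w + 1 + size_graph w * size_graph w ->
    nth false (mkseq (fun i => eval eb (one_word w) (scons i env0) != 0)
      (size_graph w + 1 + size_graph w * size_graph w)) i = (graph_bit w i != 0).
  by move=> lt_i; rewrite nth_mkseq // ebP.
split=> //.
- by move=> i lt_i; rewrite nthE; [rewrite /graph_bit lt_i|lia].
- by rewrite nthE; [rewrite /graph_bit ltnn eqxx|lia].
move=> x y; rewrite [RHS]/(gadget _ _ _ _ _ _ _ _).
have := ltn_ord x; have := ltn_ord y; move: (nat_of_ord x) (nat_of_ord y) => {}x {}y lt_y lt_x.
have lt_xy : x * size_graph w + y < size_graph w * size_graph w.
  apply: (@leq_trans (x.+1 * size_graph w)); last by rewrite leq_mul2r lt_x orbT.
  by rewrite mulSn addnC ltn_add2r.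
rewrite -(addnA (size_graph w + 1)) nthE ?ltn_add2l // -(addnA (size_graph w)) /graph_bit.
have -> : size_graph w + (1 + (x * size_graph w + y)) < size_graph w = false.
  by rewrite ltnNge leq_addr.
have -> : (size_graph w + (1 + (x * size_graph w + y)) == size_graph w) = false.
  by rewrite add1n addnS gtn_eqF // ltnS leq_addr.
rewrite addKn add1n subn1 /=.
rewrite divnMDl ?divn_small ?addn0 ?modnMDl ?modn_small //; last by apply: leq_trans lt_y.
by rewrite eqb0 negbK.
Qed.

Hypothesis nv_gt1 : forall w, 1 < nv w.
Hypothesis fa_lt : forall w q, q < nq w -> fa w q < nv w.
Hypothesis fx_lt : forall w q, q < nq w -> fx w q < nv w.
Hypothesis fy_lt : forall w q, q < nq w -> fy w q < nv w.
Hypothesis L_sat : forall w, L w <-> exists b, tie_sat (nq w) (fa w) (fx w) (fy w) b.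

(** The constructed graph is bipartite for either value of [bip], so a single reduction serves both
    problems. *)
Lemma tie_sat_reducible : poly_time_reducible L (convex_partition_language p bip).
Proof.
exists (fun w => encode_graph (@graph w)); first exact: encode_graph_computable.
move=> w; rewrite /convex_partition_language encode_graph_problem; last exact: gadget_simple.
have bnd q : q < nqp w -> [/\ fap w q < nvp w, fxp w q < nvp w & fyp w q < nvp w].
  by apply: pal_bounds; auto.
rewrite L_sat; split=> [[b b_sat]|[_ part]].
  split=> [_|]; first exact: gadget_bipartite.
  have [c c_tie] := coloring_of_tie_sat p_gt1 (nv_gt1 w) (@fa_lt w) (@fx_lt w) (@fy_lt w) b_sat.
  by apply: gadget_coloring_of_tie c_tie => // q /bnd[].
have [c c_tie] : exists c, tie_coloring p (nvp w) (nqp w) (fap w) (fxp w) (fyp w) c.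
  apply: gadget_tie_of_coloring part => //; try by move=> q /bnd[].
  exact: pal_fa_onto.
exact: (tie_sat_of_coloring p_gt1 (nv_gt1 w) (@fx_lt w) (@fy_lt w) c_tie).
Qed.

End GraphReduction.

(** * The computation tableau *)

Lemma tm_run_halted (M : tm) ws t t' : tm_halted (tm_run M ws t) -> t <= t' ->
  tm_run M ws t' = tm_run M ws t.
Proof.
move=> halted le_t; rewrite -(subnK le_t) /tm_run iterD -/(tm_run M ws t).
elim: (t' - t) => //= n ->; move: halted; rewrite /tm_halted /tm_step.
by case: (tm_next _).
Qed.

Section TapeCells.

Variable G : finType.

(* The cell at position [j - C] relative to the head. *)
Definition cell (C : nat) (t : tape G) (j : nat) : symbol G :=
  if j < C then nth None t.1.1 (C - j.+1)
  else if j == C then t.1.2 else nth None t.2 (j - C.+1).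

Lemma cell_center C t : cell C t C = tape_read t.
Proof. by rewrite /cell ltnn eqxx. Qed.

Lemma cell_stay C t a j :
  cell C (tape_move MoveStay (tape_write a t)) j = if j == C then a else cell C t j.
Proof. by rewrite /cell /=; case: ltngtP. Qed.

Lemma cell_right C t a j :
  cell C (tape_move MoveRight (tape_write a t)) j = if j.+1 == C then a else cell C t j.+1.
Proof.
case: t => [[l b] r]; rewrite /cell /tape_move /=.
case: (ltngtP j.+1 C) => [lt_j|gt_j|<-]; last by rewrite subnn.
  by have -> : C - j.+1 = (C - j.+2).+1 by lia.
case: (eqVneq j C) => [->|ne]; first by rewrite subnn nth0.
by rewrite nth_behead; congr nth; lia.
Qed.

Lemma cell_left C t a j :
  cell C (tape_move MoveLeft (tape_write a t)) j.+1 = if j == C then a else cell C t j.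
Proof.
case: t => [[l b] r]; rewrite /cell /tape_move /=.
case: (ltngtP j C) => [lt_j|gt_j|->]; last by rewrite ltnNge leqnSn /= gtn_eqF // subnn.
  case: (ltngtP j.+1 C) => [lt_j'|gt_j|<-]; [|by lia|by rewrite subnn nth0].
  by rewrite nth_behead; congr nth; lia.
rewrite ltnNge (ltnW (leqW gt_j)) gtn_eqF /=; last by lia.
by have -> : j.+1 - C.+1 = (j - C.+1).+1 by lia.
Qed.

Lemma cell_bits C w j : cell C (tape_of_bits G w) j =
  if j < C then None else nth None [seq Some (inl b) | b <- w] (j - C).
Proof.
rewrite /cell /=; case: ltngtP => [_|gt_j|->]; first by rewrite nth_nil.
- by rewrite nth_behead; congr nth; lia.
- by rewrite subnn nth0.
Qed.

End TapeCells.

Section Tableau.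

Variable M : tm.

Notation S := (symbol (tm_work M)).
Notation K := (tm_extra M).
Notation Q := (tm_state M).

Definition scan : finType := (Q * {ffun 'I_K.+1 -> S})%type.

Definition scanned (c : config M) : scan := (c.1, [ffun i => tape_read (c.2 i)]).

(** A halted machine is made to rewrite the scanned symbols and stay, so the tableau can treat all
    steps alike. *)
Definition action (k : scan) : Q * {ffun 'I_K.+1 -> S * move} :=
  odflt (k.1, [ffun i => (k.2 i, MoveStay)]) (tm_trans k.1 k.2).

Lemma tm_step_action c : tm_step c = ((action (scanned c)).1,
  [ffun i => tape_move ((action (scanned c)).2 i).2
               (tape_write ((action (scanned c)).2 i).1 (c.2 i))]).
Proof.
rewrite /tm_step /tm_next /action /=; case: (tm_trans _ _) => [[q a]|] //=.
case: c => q T /=; congr (_, _); apply/ffunP => i; rewrite !ffunE /=.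
by case: (T i) => [[]].
Qed.

(* Variables are indexed by a kind, a time [t] and a position [j]:
   [VState q]: the state at time [t] is [q];
   [VCell i a]: the cell at [j] of tape [i] holds [a];
   [VScan k m]: the state and the first [m] scanned symbols are as in [k];
   [VKeep k i a]: the scan is [k] and [j] of tape [i] holds [a];
   [VGuess]: the cell at [j] of tape 1 initially holds a bit. *)
Inductive kind :=
  | VState of Q
  | VCell of 'I_K.+1 & S
  | VScan of scan & 'I_K.+2
  | VKeep of scan & 'I_K.+1 & S
  | VGuess.

Definition kind_sum : finType :=
  (Q + ('I_K.+1 * S) + (scan * 'I_K.+2) + (scan * 'I_K.+1 * S) + unit)%type.

Definition kind_code (v : kind) : kind_sum :=
  match v with
  | VState q => inl (inl (inl (inl q)))
  | VCell i a => inl (inl (inl (inr (i, a))))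
  | VScan k m => inl (inl (inr (k, m)))
  | VKeep k i a => inl (inr (k, i, a))
  | VGuess => inr tt
  end.

Definition kind_decode (x : kind_sum) : kind :=
  match x with
  | inl (inl (inl (inl q))) => VState q
  | inl (inl (inl (inr (i, a)))) => VCell i a
  | inl (inl (inr (k, m))) => VScan k m
  | inl (inr (k, i, a)) => VKeep k i a
  | inr tt => VGuess
  end.

Lemma kind_codeK : cancel kind_code kind_decode.
Proof. by case. Qed.

Inductive rule :=
  | RStart
  | RInit of 'I_K.+1 & S
  | RGuess
  | RGuessed
  | RBlank
  | RScan0 of scan
  | RScan of scan & 'I_K.+1
  | RState of scan
  | RKeep of scan & 'I_K.+1 & S
  | RMove of scan & 'I_K.+1 & S
  | RWrite of scan & 'I_K.+1
  | RAccept of Q.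

Definition rule_sum : finType :=
  ('I_4 + ('I_K.+1 * S) + scan + (scan * 'I_K.+1) + scan + (scan * 'I_K.+1 * S)
   + (scan * 'I_K.+1 * S) + (scan * 'I_K.+1) + Q)%type.

Definition rule_code (r : rule) : rule_sum :=
  match r with
  | RStart => inl (inl (inl (inl (inl (inl (inl (inl ord0)))))))
  | RGuess => inl (inl (inl (inl (inl (inl (inl (inl (inord 1))))))))
  | RGuessed => inl (inl (inl (inl (inl (inl (inl (inl (inord 2))))))))
  | RBlank => inl (inl (inl (inl (inl (inl (inl (inl (inord 3))))))))
  | RInit i a => inl (inl (inl (inl (inl (inl (inl (inr (i, a))))))))
  | RScan0 k => inl (inl (inl (inl (inl (inl (inr k))))))
  | RScan k i => inl (inl (inl (inl (inl (inr (k, i))))))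
  | RState k => inl (inl (inl (inl (inr k))))
  | RKeep k i a => inl (inl (inl (inr (k, i, a))))
  | RMove k i a => inl (inl (inr (k, i, a)))
  | RWrite k i => inl (inr (k, i))
  | RAccept q => inr q
  end.

Definition rule_decode (x : rule_sum) : rule :=
  match x with
  | inl (inl (inl (inl (inl (inl (inl (inl j))))))) =>
      nth RStart [:: RStart; RGuess; RGuessed; RBlank] j
  | inl (inl (inl (inl (inl (inl (inl (inr (i, a)))))))) => RInit i a
  | inl (inl (inl (inl (inl (inl (inr k)))))) => RScan0 k
  | inl (inl (inl (inl (inl (inr (k, i)))))) => RScan k i
  | inl (inl (inl (inl (inr k)))) => RState k
  | inl (inl (inl (inr (k, i, a)))) => RKeep k i a
  | inl (inl (inr (k, i, a))) => RMove k i a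
  | inl (inr (k, i)) => RWrite k i
  | inr q => RAccept q
  end.

Lemma rule_codeK : cancel rule_code rule_decode.
Proof. by case=> //=; rewrite ?inordK. Qed.

Inductive ref := Lit of bool | Var of kind & nat & nat.

Variables time_deg cert_deg : nat.

Section Input.

Variable w : seq bool.

Definition cert_bound := poly_bound cert_deg (size w).
(** The number of steps must depend on [w] alone, hence the longest admissible certificate in the
    time bound. The last summand makes the window wide enough to contain the certificate. *)
Definition horizon := poly_bound time_deg (size w + cert_bound) + cert_bound.
Definition center := horizon.+1.
(** There are [horizon + 1] cells on each side of [center], so the scanned cell is still in the
    forced region after [horizon] steps. Times are numbered in the same range, which gives one radix
    for both coordinates. *)
Definition width := 2 * horizon + 3.

Definition tape1 : 'I_K.+1 := inord 1.

(* Tape 0 holds the input and tape 1, if it exists, a certificate of length at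
   most [cert_bound], of which only the blank surroundings are prescribed. *)
Definition init_cond (i : 'I_K.+1) (a : S) (j : nat) : bool :=
  match a with
  | None =>
      if i == 0 :> nat then (j < center) || (bit_at w (j - center) == 2)
      else if i == 1 :> nat then (j < center) || (center + cert_bound <= j)
      else true
  | Some (inl b) =>
      [&& i == 0 :> nat, center <= j & bit_at w (j - center) == b]
  | Some (inr _) => false
  end.

Definition moved_cond (m : move) (j : nat) : bool :=
  match m with
  | MoveLeft => j.+1 < width
  | MoveStay => true
  | MoveRight => 0 < j
  end.

Definition moved (m : move) (j : nat) : nat :=
  match m with MoveLeft => j.+1 | MoveStay => j | MoveRight => j - 1 end.

Definition rule_cond (r : rule) (t j : nat) : bool :=
  match r with
  | RStart => t == 0
  | RInit i a => (t == 0) && init_cond i a j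
  | RGuess | RGuessed =>
      [&& 0 < K, t == 0, center <= j & j < center + cert_bound]
  | RBlank => [&& 0 < K, t == 0, center <= j & j.+1 < center + cert_bound]
  | RScan0 k => true
  | RScan k i => true
  | RState k => t.+1 < width
  | RKeep k i a => j != center
  | RMove k i a => [&& t.+1 < width, j != center & moved_cond ((action k).2 i).2 j]
  | RWrite k i => t.+1 < width
  | RAccept q => ~~ tm_accept q && (t == horizon)
  end.

(* A rule generates the constraint (a; x, y) with these three components. *)
Definition rule_refs (r : rule) (t j : nat) : ref * ref * ref :=
  match r with
  | RStart => (Var (VState (tm_start M)) 0 0, Lit true, Lit true)
  | RInit i a => (Var (VCell i a) 0 j, Lit true, Lit true)
  | RGuess => (Var VGuess 0 j, Var (VCell tape1 (Some (inl false))) 0 j,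
               Var (VCell tape1 (Some (inl true))) 0 j)
  | RGuessed => (Lit true, Var VGuess 0 j, Var (VCell tape1 None) 0 j)
  | RBlank => (Var (VCell tape1 None) 0 j.+1, Var (VCell tape1 None) 0 j, Lit true)
  | RScan0 k => (Var (VScan k ord0) t 0, Var (VState k.1) t 0, Lit true)
  | RScan k i => (Var (VScan k (lift ord0 i)) t 0, Var (VScan k (widen_ord (leqnSn _) i)) t 0,
                  Var (VCell i (k.2 i)) t center)
  | RState k => (Var (VState (action k).1) t.+1 0, Var (VScan k ord_max) t 0, Lit true)
  | RKeep k i a => (Var (VKeep k i a) t j, Var (VScan k ord_max) t 0, Var (VCell i a) t j)
  | RMove k i a => (Var (VCell i a) t.+1 (moved ((action k).2 i).2 j),
                    Var (VKeep k i a) t j, Lit true)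
  | RWrite k i => (Var (VCell i ((action k).2 i).1) t.+1 (moved ((action k).2 i).2 center),
                   Var (VScan k ord_max) t 0, Lit true)
  | RAccept q => (Var (VState q) t 0, Lit false, Lit false)
  end.

Definition ref_val (b : kind -> nat -> nat -> bool) (x : ref) : bool :=
  match x with Lit c => c | Var v t j => b v t j end.

Definition tableau_sat (b : kind -> nat -> nat -> bool) : Prop :=
  forall r t j, t < width -> j < width -> rule_cond r t j ->
  let: (a, x, y) := rule_refs r t j in
  ref_val b x = ref_val b y -> ref_val b a = ref_val b x.

Definition var_number (v : kind) (t j : nat) : nat :=
  2 + ((enum_rank (kind_code v) * width + t) * width + j).

Definition ref_number (x : ref) : nat :=
  match x with Lit true => 0 | Lit false => 1 | Var v t j => var_number v t j end.

Definition tableau_nv := 2 + #|kind_sum| * width * width.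
Definition tableau_nq := #|rule_sum| * width * width.

Definition rule_of (q : nat) : rule :=
  rule_decode (nth (rule_code RStart) (enum rule_sum) (q %/ width %/ width)).
Definition time_of (q : nat) : nat := q %/ width %% width.
Definition pos_of (q : nat) : nat := q %% width.

(** A rule that does not apply yields the trivial constraint (0; 0, 0), which keeps the number of
    constraints a simple formula. *)
Definition tableau_comp (f : ref * ref * ref -> ref) (q : nat) : nat :=
  if rule_cond (rule_of q) (time_of q) (pos_of q)
  then ref_number (f (rule_refs (rule_of q) (time_of q) (pos_of q))) else 0.

Definition tableau_fa := tableau_comp (fun c => c.1.1).
Definition tableau_fx := tableau_comp (fun c => c.1.2).
Definition tableau_fy := tableau_comp (fun c => c.2).

Lemma mixed_radixP (n a b c : nat) : b < n -> c < n ->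
  let q := (a * n + b) * n + c in
  [/\ q %/ n %/ n = a, q %/ n %% n = b & q %% n = c].
Proof.
move=> lt_b lt_c q; have n_gt0 : 0 < n by apply: leq_trans lt_c.
have -> : q %/ n = a * n + b by rewrite /q divnMDl // divn_small ?addn0.
by rewrite divnMDl // divn_small // addn0 modnMDl modn_small // /q modnMDl modn_small.
Qed.

Lemma radix_lt (n m a b : nat) : a < m -> b < n -> a * n + b < m * n.
Proof.
move=> lt_a lt_b; apply: (@leq_trans (a.+1 * n)); last by rewrite leq_mul2r lt_a orbT.
by rewrite mulSn addnC ltn_add2r.
Qed.

Lemma mixed_radix_lt (n m a b c : nat) : a < m -> b < n -> c < n ->
  (a * n + b) * n + c < m * n * n.
Proof. by move=> *; do 2?apply: radix_lt. Qed.

Definition rule_number (r : rule) (t j : nat) : nat :=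
  (enum_rank (rule_code r) * width + t) * width + j.

Lemma rule_numberP r t j : t < width -> j < width ->
  [/\ rule_number r t j < tableau_nq, rule_of (rule_number r t j) = r,
      time_of (rule_number r t j) = t & pos_of (rule_number r t j) = j].
Proof.
move=> lt_t lt_j; have [rE tE jE] := mixed_radixP (enum_rank (rule_code r)) lt_t lt_j.
split=> //; first exact: mixed_radix_lt.
by rewrite /rule_of rE nth_enum_rank rule_codeK.
Qed.

Lemma time_of_lt q : q < tableau_nq -> time_of q < width.
Proof. by rewrite ltn_mod /width; lia. Qed.

Lemma pos_of_lt q : q < tableau_nq -> pos_of q < width.
Proof. by rewrite ltn_mod /width; lia. Qed.

Definition ref_ok (x : ref) : bool :=
  if x is Var v t j then (t < width) && (j < width) else true.

Lemma horizon_bounds : cert_bound <= horizon.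
Proof. by rewrite /horizon leq_addl. Qed.

Lemma rule_refs_ok r t j : t < width -> j < width -> rule_cond r t j ->
  let: (a, x, y) := rule_refs r t j in [&& ref_ok a, ref_ok x & ref_ok y].
Proof.
have cw : center < width by rewrite /center /width; lia.
have w0 : 0 < width by rewrite /width; lia.
have cb := horizon_bounds.
move=> lt_t lt_j; case: r => [|i a||||k|k i|k|k i a|k i a|k i|q] /= H; rewrite ?lt_t ?lt_j ?w0 ?cw //=.
- by case/and4P: H => _ _ _; rewrite /center /width; lia.
- by rewrite H.
- by case/and3P: H => -> _; case: (_.2) => /=; rewrite ?lt_j //; lia.
- by rewrite H; case: (_.2) => /=; rewrite ?cw // /center /width; lia.
Qed.

Lemma ref_number_lt x : ref_ok x -> ref_number x < tableau_nv.
Proof.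
case: x => [[]|v t j] //= /andP[lt_t lt_j].
by rewrite /var_number /tableau_nv ltn_add2l mixed_radix_lt.
Qed.

Lemma tableau_comp_lt f q :
  (forall a x y, [&& ref_ok a, ref_ok x & ref_ok y] -> ref_ok (f (a, x, y))) ->
  q < tableau_nq -> tableau_comp f q < tableau_nv.
Proof.
move=> f_ok lt_q; rewrite /tableau_comp; case: ifP => // cond.
have := rule_refs_ok (time_of_lt lt_q) (pos_of_lt lt_q) cond.
by case: (rule_refs _ _ _) => [[a x] y] /f_ok /ref_number_lt.
Qed.

Lemma tableau_tie_sat : (exists b, tie_sat tableau_nq tableau_fa tableau_fx tableau_fy b) <->
  (exists b, tableau_sat b).
Proof.
split=> [[b [b0 b1 b_tie]]|[b b_sat]].
  pose b' v t j := b (var_number v t j).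
  have valE x : ref_val b' x = b (ref_number x) by case: x => [[]|].
  exists b' => r t j lt_t lt_j cond.
  have [lt_q rE tE jE] := rule_numberP r lt_t lt_j.
  have := b_tie _ lt_q.
  rewrite /tableau_fa /tableau_fx /tableau_fy /tableau_comp rE tE jE cond.
  by case: (rule_refs _ _ _) => [[a x] y]; rewrite !valE.
pose var_of n := kind_decode (nth (kind_code VGuess) (enum kind_sum) (n %/ width %/ width)).
pose b' n := if n is m.+2 then b (var_of m) (m %/ width %% width) (m %% width) else n == 0.
have valE x : ref_ok x -> b' (ref_number x) = ref_val b x.
  case: x => [[]|v t j] //= /andP[lt_t lt_j].
  have [vE tE jE] := mixed_radixP (enum_rank (kind_code v)) lt_t lt_j.
  by rewrite tE jE /var_of vE nth_enum_rank kind_codeK.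
exists b'; split=> // q lt_q.
rewrite /tableau_fa /tableau_fx /tableau_fy /tableau_comp.
case: ifP => // cond; have [lt_t lt_j] := (time_of_lt lt_q, pos_of_lt lt_q).
have := b_sat _ _ _ lt_t lt_j cond; have := rule_refs_ok lt_t lt_j cond.
case: (rule_refs _ _ _) => [[a x] y] /and3P[a_ok x_ok y_ok] /=.
by rewrite !valE.
Qed.

Definition truth (u : seq bool) (v : kind) (t j : nat) : bool :=
  let c := tm_run M [:: w; u] t in
  match v with
  | VState q => c.1 == q
  | VCell i a => cell center (c.2 i) j == a
  | VScan k m => (c.1 == k.1) && [forall i : 'I_K.+1, (i < m) ==> (tape_read (c.2 i) == k.2 i)]
  | VKeep k i a => (scanned c == k) && (cell center (c.2 i) j == a)
  | VGuess => if cell center (c.2 tape1) j is Some (inl _) then true else false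
  end.

Lemma truth_scan u k t : truth u (VScan k ord_max) t 0 = (scanned (tm_run M [:: w; u] t) == k).
Proof.
rewrite /truth /scanned; case: k => q f /=; rewrite xpair_eqE; congr (_ && _).
apply/forallP/eqP => [H|<- i]; last by rewrite ffunE eqxx implybT.
by apply/ffunP => i; rewrite ffunE; apply/eqP; have := H i; rewrite ltn_ord.
Qed.

Lemma truth_scanS u k (i : 'I_K.+1) t : truth u (VScan k (lift ord0 i)) t 0 =
  truth u (VScan k (widen_ord (leqnSn _) i)) t 0 && truth u (VCell i (k.2 i)) t center.
Proof.
rewrite /truth cell_center -andbA /=; congr (_ && _).
apply/forallP/andP => [H|[/forallP H Hi] j].
  split; last by have /implyP := H i; apply; rewrite /bump.
  by apply/forallP => j; apply/implyP => lt_j; have /implyP := H j; apply; rewrite /bump /=; lia.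
apply/implyP; rewrite /bump /= add1n ltnS leq_eqVlt => /orP[/eqP/val_inj -> //|].
exact/implyP.
Qed.

Lemma tm_runS ws t : tm_run M ws t.+1 = tm_step (tm_run M ws t).
Proof. by []. Qed.

Lemma cell_init u (i : 'I_K.+1) j : cell center ((tm_run M [:: w; u] 0).2 i) j =
  if j < center then None
  else nth None [seq Some (inl b) | b <- nth [::] [:: w; u] i] (j - center).
Proof. by rewrite /= ffunE cell_bits. Qed.

Lemma nth_bits (G : finType) (s : seq bool) n :
  nth (None : symbol G) [seq Some (inl b) | b <- s] n =
  if n < size s then Some (inl (nth false s n)) else None.
Proof.
case: ltnP => lt_n; first by rewrite (nth_map false).
by rewrite nth_default // size_map.
Qed.

Lemma bit_at2 s n : (bit_at s n == 2) = (size s <= n).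
Proof. by rewrite /bit_at; case: ltnP => // _; case: (nth _ _ _). Qed.

Lemma cell_moved (T : tape (tm_work M)) a m j : moved_cond m j ->
  cell center (tape_move m (tape_write a T)) (moved m j) =
  if j == center then a else cell center T j.
Proof.
case: m => /= H; [exact: cell_left|exact: cell_stay|].
by case: j H => // j _; rewrite subn1 cell_right.
Qed.

Lemma truth_sat u : size u <= cert_bound ->
  tm_accept (tm_run M [:: w; u] horizon).1 -> tableau_sat (truth u).
Proof.
move=> size_u acc r t j lt_t lt_j.
have K1 : 0 < K -> tape1 = 1 :> nat by move=> K_gt0; rewrite /tape1 inordK.
case: r => [|i a||||k|k i|k|k i a|k i a|k i|q] cond; rewrite /rule_refs /ref_val.
- by rewrite /truth /= eqxx.
- move=> _; move: cond => /= /andP[_ cond]; rewrite ffunE cell_bits nth_bits.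
  apply/eqP; move: cond; rewrite /init_cond.
  case: a => [[b|//]|].
    case/and3P=> /eqP -> le_j; rewrite /bit_at [j < _]ltnNge le_j /=.
    by case: ltnP => _; case: b; case: (nth false w _).
  case: (i =P 0 :> nat) => [->|i0].
    by rewrite bit_at2 /=; case: (ltnP j center) => //= _; case: ltnP.
  case: (i =P 1 :> nat) => [->|i1].
    case: (ltnP j center) => //= le_j H; rewrite ifF //; apply/negbTE; rewrite -leqNgt.
    by apply: leq_trans size_u _; rewrite leq_subRL.
  by rewrite [nth [::] _ _]nth_default /=; [case: ifP|lia].
- rewrite /truth /= ffunE cell_bits nth_bits.
  by case: ifP => // _; case: ifP => // _; case: (nth false _ _).
- move: cond => /= /and4P[/K1 t1 _ le_j lt_j']; rewrite ffunE cell_bits nth_bits t1 /=.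
  by rewrite [j < _]ltnNge le_j /=; case: ifP.
- move: cond => /= /and4P[/K1 t1 _ le_j lt_j']; rewrite ffunE !cell_bits !nth_bits t1 /=.
  rewrite [j < _]ltnNge le_j /= [j.+1 < _]ltnNge (leqW le_j) /=.
  case: ltnP => // le_u _; rewrite ifF //; apply/negbTE; rewrite -leqNgt.
  by apply: leq_trans le_u _; rewrite leq_sub2r.
- by rewrite /truth /=; case: eqP => //= _ _; apply/forallP => i.
- by rewrite truth_scanS; case: (truth u _ t 0); case: (truth u _ t center).
- rewrite truth_scan /truth tm_runS tm_step_action => /eqP ->.
  by rewrite !eqxx.
(* False premises must make the conclusion false as well. This holds for [VKeep], but would fail for
   the cell at time [t.+1], which can hold [a] after another scan; hence the intermediate
   variable. *)
- rewrite truth_scan /truth /=; case: (_ == k) => //=.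
- rewrite /rule_cond in cond; case/and3P: cond => _ jc mv.
  rewrite /truth tm_runS tm_step_action /= ffunE => /andP[/eqP -> /eqP ca].
  by rewrite cell_moved // (negbTE jc) ca !eqxx.
- rewrite truth_scan /truth tm_runS tm_step_action /= ffunE => /eqP ->.
  by rewrite cell_moved ?eqxx //=; case: (((action k).2 i).2) => //; rewrite /= /center /width; lia.
- by move: cond => /= /andP[nacc /eqP ->] _; rewrite /truth; apply/negbTE; apply: contraNneq nacc => <-.
Qed.

Section Decode.

Variable b : kind -> nat -> nat -> bool.
Hypothesis b_sat : tableau_sat b.

(** Several symbols may be true at one cell. Stopping at the first blank and preferring the bit true
    resolves this; where that bit is not true, the bit false must be. *)
Definition decoded_cert : seq bool :=
  mkseq (fun j => b (VCell tape1 (Some (inl true))) 0 (center + j))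
    (find (fun j => b (VCell tape1 None) 0 (center + j)) (iota 0 cert_bound)).

Lemma size_decoded_cert : size decoded_cert <= cert_bound.
Proof. by rewrite size_mkseq -[X in _ <= X](size_iota 0) find_size. Qed.

Lemma width_gt0 : 0 < width.
Proof. by rewrite /width; lia. Qed.

(** Before the first blank the two guessing rules force some bit to be true; from that blank on,
    [RBlank] propagates blanks to the right. *)
Lemma decoded_cert_cell j : 0 < K -> j < cert_bound ->
  b (VCell tape1 (nth None [seq Some (inl c) | c <- decoded_cert] j)) 0 (center + j).
Proof.
move=> K_gt0 lt_j; have cb := horizon_bounds.
have in_width i : i < cert_bound -> center + i < width by rewrite /center /width; lia.
have rcond i : i < cert_bound -> rule_cond RGuess 0 (center + i).
  by move=> lt_i; rewrite /= K_gt0 leq_addr ltn_add2l.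
rewrite nth_bits size_mkseq; set m := find _ _.
case: ltnP => [lt_m|le_m].
  rewrite nth_mkseq //.
  have := before_find 0 lt_m; rewrite nth_iota // add0n => noblank.
  have /= guess := b_sat width_gt0 (in_width j lt_j) (rcond j lt_j).
  have /= guessed := @b_sat RGuessed 0 _ width_gt0 (in_width j lt_j) (rcond j lt_j).
  move: guess guessed; rewrite noblank; case: (b VGuess _ _); last by move=> _ /(_ erefl).
  case E: (b (VCell tape1 (Some (inl true))) 0 (center + j)); first by rewrite E.
  by case: (b (VCell tape1 (Some (inl false))) 0 (center + j)) => // /(_ erefl).
have m_lt : m < cert_bound by apply: leq_ltn_trans le_m lt_j.
have blank_m : b (VCell tape1 None) 0 (center + m).
  have : has (fun j => b (VCell tape1 None) 0 (center + j)) (iota 0 cert_bound).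
    by rewrite has_find size_iota.
  by move/(nth_find 0); rewrite -/m nth_iota // add0n.
suff blank_from n : m + n < cert_bound -> b (VCell tape1 None) 0 (center + (m + n)).
  by rewrite -(subnKC le_m); apply: blank_from; rewrite subnKC.
elim: n => [|n IH] lt_n; first by rewrite addn0.
have lt_n' : m + n < cert_bound by apply: leq_ltn_trans lt_n; rewrite leq_add2l.
have cond : rule_cond RBlank 0 (center + (m + n)).
  by rewrite /= K_gt0 leq_addr -addnS ltn_add2l -addnS.
have /= := b_sat width_gt0 (in_width _ lt_n') cond.
by rewrite IH // !addnS => ->.
Qed.

Lemma decoded_init i j : j < width ->
  b (VCell i (cell center ((tm_run M [:: w; decoded_cert] 0).2 i) j)) 0 j.
Proof.
move=> lt_j; rewrite cell_init.
have init a : init_cond i a j -> b (VCell i a) 0 j.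
  move=> cond; have cond' : rule_cond (RInit i a) 0 j by [].
  by have /= := b_sat width_gt0 lt_j cond'; apply.
case: (i =P 0 :> nat) => [i0|i0].
  case: (ltnP j center) => [lt_c|le_c].
    by apply: init; rewrite /init_cond i0 /= lt_c.
  rewrite i0 /= nth_bits; case: (ltnP (j - center) (size w)) => lt_w; apply: init.
    by rewrite /init_cond i0 /= le_c /bit_at lt_w eqxx.
  by rewrite /init_cond i0 /= bit_at2 lt_w orbT.
case: (i =P 1 :> nat) => [i1|i1]; last first.
  have -> : (if j < center then None
    else nth None [seq Some (inl c) | c <- nth [::] [:: w; decoded_cert] i] (j - center)) = None :> S.
    by rewrite [nth [::] _ _]nth_default /=; [rewrite nth_nil if_same|lia].
  by apply: init; rewrite /init_cond !ifN //; apply/eqP.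
have K_gt0 : 0 < K by have := ltn_ord i; rewrite i1 ltnS.
have iE : i = tape1 by apply: val_inj; rewrite /= i1 /tape1 inordK.
case: (ltnP j center) => [lt_c|le_c].
  by apply: init; rewrite /init_cond i1 /= lt_c.
rewrite i1 /=; case: (ltnP (j - center) cert_bound) => lt_b.
  by have := decoded_cert_cell K_gt0 lt_b; rewrite subnKC // -iE.
rewrite nth_bits ltnNge (leq_trans size_decoded_cert lt_b) /=.
by apply: init; rewrite /init_cond i1 /= -leq_subRL // lt_b orbT.
Qed.

Let c t := tm_run M [:: w; decoded_cert] t.

(* Nothing is known beyond the ends of the window, so the part of it in which the
   tableau is forced shrinks by one cell on each side at each step. *)
Lemma decoded_run t : t <= horizon ->
  b (VState (c t).1) t 0 /\
  forall i j, t <= j -> j + t < width -> b (VCell i (cell center ((c t).2 i) j)) t j.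
Proof.
elim: t => [|t IH] le_t.
  split=> [|i j _]; last by rewrite addn0; apply: decoded_init.
  by have /= := @b_sat RStart 0 0 width_gt0 width_gt0 isT; apply.
have [state_t cell_t] := IH (ltnW le_t).
have lt_t1 : t.+1 < width by rewrite /width; lia.
have lt_t := ltnW lt_t1.
have lt_c : center < width by rewrite /center /width; lia.
set k := scanned (c t).
have imp r j a x : j < width -> rule_cond r t j -> rule_refs r t j = (a, x, Lit true) ->
    ref_val b x -> ref_val b a.
  by move=> lt_j cond E; have := b_sat lt_t lt_j cond; rewrite E => H xT; rewrite H.
have scan_t (m : 'I_K.+2) : b (VScan k m) t 0.
  case: m => m; elim: m => [|m IHm] lt_m.
    have -> : Ordinal lt_m = ord0 by apply: val_inj.
    exact: (imp (RScan0 k) 0 _ _ width_gt0 isT erefl).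
  pose i : 'I_K.+1 := Ordinal (lt_m : m < K.+1).
  have -> : Ordinal lt_m = lift ord0 i by apply: val_inj.
  have := @b_sat (RScan k i) t 0 lt_t width_gt0 isT; rewrite /rule_refs /ref_val.
  have -> : b (VScan k (widen_ord (leqnSn _) i)) t 0.
    have -> : widen_ord (leqnSn _) i = Ordinal (leqW lt_m : m < K.+2) by apply: val_inj.
    exact: IHm.
  have -> : b (VCell i (k.2 i)) t center.
    rewrite /k /scanned ffunE -(cell_center center).
    by apply: cell_t; rewrite /center /width; lia.
  by move/(_ erefl).
rewrite /c tm_runS tm_step_action -/(c t) -/k; split=> [|i j' le_j lt_j] /=.
  exact: (imp (RState k) 0 _ _ width_gt0 lt_t1 erefl (scan_t ord_max)).
rewrite ffunE; set a := ((action k).2 i).1; set m := ((action k).2 i).2.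
have [j [jE mj le_tj lt_jt]] : exists j, [/\ j' = moved m j, moved_cond m j, t <= j & j + t < width].
  case: m => /=.
  - by case: j' le_j lt_j => // j le_j lt_j; exists j; split=> //; lia.
  - by exists j'; split=> //; lia.
  - by exists j'.+1; rewrite subn1; split=> //; lia.
rewrite jE cell_moved //; case: (eqVneq j center) => [->|jc].
  exact: (imp (RWrite k i) 0 _ _ width_gt0 lt_t1 erefl (scan_t ord_max)).
have lt_jw : j < width by apply: leq_ltn_trans lt_jt; apply: leq_addr.
set a' := cell _ _ _.
have keep : b (VKeep k i a') t j.
  have := @b_sat (RKeep k i a') t j lt_t lt_jw jc; rewrite /rule_refs /ref_val scan_t cell_t //.
  by move/(_ erefl).
apply: (imp (RMove k i a') j _ _ lt_jw _ erefl keep).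
by rewrite /rule_cond lt_t1 jc.
Qed.

(** It is enough that the facts of the actual run are true in [b]: its last state is then true, and
    [RAccept] forbids this for a nonaccepting state. *)
Lemma decoded_accepting : tm_accept (c horizon).1.
Proof.
have [state_T _] := decoded_run (leqnn _); apply/negPn/negP => nacc.
have lt_T : horizon < width by rewrite /width; lia.
have := @b_sat (RAccept (c horizon).1) horizon 0 lt_T width_gt0.
by rewrite /rule_cond nacc eqxx /= state_T => /(_ isT erefl).
Qed.

End Decode.

Lemma tableau_satP :
  (exists b, tableau_sat b) <->
  exists2 u, size u <= cert_bound & tm_accept (tm_run M [:: w; u] horizon).1.
Proof.
split=> [[b b_sat]|[u size_u acc]]; last by exists (truth u); apply: truth_sat.
by exists (decoded_cert b); [apply: size_decoded_cert|apply: decoded_accepting].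
Qed.

End Input.
End Tableau.

(** A case distinction over a fixed finite type unfolds into nested conditionals. Applied to the
    rules of a fixed machine, it gives one expression for all inputs. *)
Lemma expr_case (F : finType) (x0 : F) (g : F -> inputs -> env -> nat) idx :
  (forall x, expressible (g x)) -> expressible idx ->
  expressible (fun W s => g (nth x0 (enum F) (idx W s)) W s).
Proof.
move=> g_expr; elim: (enum F) idx => [|x l IH] idx idx_expr.
  by apply: expr_ext (g_expr x0) => W s; rewrite nth_nil.
have := expr_if (expr_leq idx_expr (expr_const 0)) (g_expr x)
  (IH _ (expr_sub idx_expr (expr_const 1))).
by apply: expr_ext => W s; case: (idx W s) => //= n; rewrite subn1.
Qed.

(** * Expressibility of the tableau and NP-hardness *)

Section CookLevin.

Variables (M : tm) (time_deg cert_deg : nat).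

Notation horizon' := (horizon time_deg cert_deg).
Notation center' := (center time_deg cert_deg).
Notation width' := (width time_deg cert_deg).

Lemma cert_bound_expr : input_expressible (cert_bound cert_deg).
Proof. by rewrite /input_expressible /cert_bound; expr. Qed.

Lemma horizon_expr : input_expressible horizon'.
Proof.
by rewrite /input_expressible /horizon; repeat first [expr_step | exact: cert_bound_expr].
Qed.

Lemma center_expr : input_expressible center'.
Proof. exact: expr_succ horizon_expr. Qed.

Lemma width_expr : input_expressible width'.
Proof.
by rewrite /input_expressible /width; repeat first [expr_step | exact: horizon_expr].
Qed.

Ltac expr_tableau := repeat first [expr_step | exact: width_expr | exact: center_expr
  | exact: horizon_expr | exact: cert_bound_expr].

Lemma tableau_nv_expr : input_expressible (tableau_nv M time_deg cert_deg).
Proof. by rewrite /input_expressible /tableau_nv; expr_tableau. Qed.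

Lemma tableau_nq_expr : input_expressible (tableau_nq M time_deg cert_deg).
Proof. by rewrite /input_expressible /tableau_nq; expr_tableau. Qed.

Lemma init_cond_expr i a : expressible (fun W s =>
  @init_cond M time_deg cert_deg (W false) i a (s 0)).
Proof.
rewrite /init_cond; case: a => [[b|g]|]; [by expr_tableau|exact: expr_const|].
case: (i == 0 :> nat); first by expr_tableau.
by case: (i == 1 :> nat); [expr_tableau|exact: expr_const].
Qed.

Lemma rule_cond_expr r : expressible (fun W s =>
  @rule_cond M time_deg cert_deg (W false) r (s 0) (s 1)).
Proof.
case: r => [|i a||||k|k i|k|k i a|k i a|k i|q]; rewrite /rule_cond; try by expr_tableau.
  apply: expr_and; first by expr.
  apply: (expr_comp1 (f := fun W j => @init_cond M time_deg cert_deg (W false) i a j : nat)).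
    exact: init_cond_expr.
  exact: expr_var.
by apply: expr_and; [|apply: expr_and]; [..|case: (_.2) => /=]; expr_tableau.
Qed.

Definition ref_expressible (x : inputs -> env -> ref M) : Prop :=
  expressible (fun W s => ref_number time_deg cert_deg (W false) (x W s)).

Lemma ref_lit_expr c : ref_expressible (fun _ _ => Lit M c).
Proof. by rewrite /ref_expressible; case: c; exact: expr_const. Qed.

Lemma ref_var_expr v t j : expressible t -> expressible j ->
  ref_expressible (fun W s => Var v (t W s) (j W s)).
Proof.
by move=> ? ?; rewrite /ref_expressible /ref_number /var_number; expr_tableau.
Qed.

Lemma rule_refs_expr r :
  let refs W s := @rule_refs M time_deg cert_deg (W false) r (s 0) (s 1) in
  [/\ ref_expressible (fun W s => (refs W s).1.1), ref_expressible (fun W s => (refs W s).1.2)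
    & ref_expressible (fun W s => (refs W s).2)].
Proof.
move=> refs; rewrite {}/refs.
case: r => [|i a||||k|k i|k|k i a|k i a|k i|q]; rewrite /rule_refs /=; split;
  first [exact: ref_lit_expr | apply: ref_var_expr; try case: (_.2) => /=; expr_tableau].
Qed.

Lemma tableau_comp_expr f :
  (forall r, ref_expressible (fun W s =>
     f (@rule_refs M time_deg cert_deg (W false) r (s 0) (s 1)))) ->
  input_expressible1 (fun w => @tableau_comp M time_deg cert_deg w f).
Proof.
move=> f_expr.
pose g x W t j := let r := rule_decode x in
  if @rule_cond M time_deg cert_deg (W false) r t j
  then ref_number time_deg cert_deg (W false) (f (rule_refs time_deg cert_deg (W false) r t j))
  else 0.
apply: (expr_case (rule_code (RStart M)) (g := fun x W s =>
  g x W (@time_of time_deg cert_deg (W false) (s 0)) (@pos_of time_deg cert_deg (W false) (s 0)))).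
  move=> x; apply: (expr_comp2 (f := g x)); rewrite /time_of /pos_of; try by expr_tableau.
  by apply: expr_if; [exact: rule_cond_expr|exact: f_expr|exact: expr_const].
by expr_tableau.
Qed.

End CookLevin.

(* The Cook-Levin theorem, with tie constraints in place of clauses. *)
Lemma convex_partition_NP_hard p bip : 1 < p -> NP_hard (convex_partition_language p bip).
Proof.
move=> p_gt1 L [R [cert_deg [[M [time_deg MP]] LP]]].
apply: (tie_sat_reducible bip p_gt1 (tableau_nv_expr M time_deg cert_deg)
  (tableau_nq_expr M time_deg cert_deg)
  (fa := tableau_fa M time_deg cert_deg) (fx := tableau_fx M time_deg cert_deg)
  (fy := tableau_fy M time_deg cert_deg)).
- by apply: tableau_comp_expr => r; case: (rule_refs_expr time_deg cert_deg r).
- by apply: tableau_comp_expr => r; case: (rule_refs_expr time_deg cert_deg r).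
- by apply: tableau_comp_expr => r; case: (rule_refs_expr time_deg cert_deg r).
- by move=> w; rewrite /tableau_nv; lia.
- by move=> w q; apply: tableau_comp_lt => a x y /and3P[].
- by move=> w q; apply: tableau_comp_lt => a x y /and3P[].
- by move=> w q; apply: tableau_comp_lt => a x y /and3P[].
move=> w; rewrite tableau_tie_sat tableau_satP LP.
split=> [[u size_u Ru]|[u size_u acc]]; exists u => //; have [halted accP] := MP w u.
(* The time bound of [M] depends on [size u], the horizon does not; they agree because [M] has
   halted by then and its configuration no longer changes. *)
all: have run_eq : tm_run M [:: w; u] (horizon time_deg cert_deg w) =
    tm_run M [:: w; u] (poly_bound time_deg (size w + size u)).
1,3: apply: tm_run_halted => //; rewrite /horizon; apply: leq_trans (leq_addr _ _);
  by apply: poly_bound_mono; rewrite leq_add2l.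
- by rewrite run_eq; apply/accP.
- by apply/accP; rewrite -run_eq.
Qed.

Lemma NP_complete_ext (L L' : language) : (forall w, L w <-> L' w) ->
  NP_complete L -> NP_complete L'.
Proof.
move=> LL' [[R [k [R_dec LR]]] hard]; split.
  by exists R, k; split=> // w; rewrite -LL'.
by move=> L0 /hard[f f_comp f_red]; exists f => // w; rewrite f_red.
Qed.

Lemma convex_partition_NP_complete p bip : 1 < p ->
  NP_complete (convex_partition_language p bip).
Proof. by move=> p_gt1; split; [apply: bipartite_flag_in_NP|apply: convex_partition_NP_hard]. Qed.

Theorem mainTheorem4 (p : nat) (hp : 2 <= p) :
  NP_complete (P3star_convex_partition_problem p) /\
  NP_complete (bipartite_P3star_convex_partition_problem p).
Proof.
split.
  apply: NP_complete_ext (convex_partition_NP_complete false hp) => w.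
  by split=> [[n [e [? ? []]]]|[n [e [? ? ?]]]]; exists n, e.
apply: NP_complete_ext (convex_partition_NP_complete true hp) => w.
split=> [[n [e [? ? [bip part]]]]|[n [e [? ? [bip part]]]]]; exists n, e; split=> //; split=> //.
exact: bip.
Qed.
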